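(* Let $p$ be a prime and let $m,n$ be positive integers such that $n\mid p-1$ and $\gcd(m,n)=1$. Put $h=\gcd(m,p-1)$. Then $$M_{m,n}\lesssim\begin{cases} h^{1/4}n^{-1/4}p^{11/12}, & \text{if } p^{29/48}\le n<p^{2/3},\\ h^{1/4}n^{-21/52}p^{105/104}, & \text{if } p^{59/112}\le n<p^{29/48},\\ h^{1/4}n^{-7/20}p^{157/160}, & \text{if } p^{1/2}\le n<p^{59/112},\\ h^{1/4}n^{-31/80}p, & \text{if } n<p^{1/2}.\end{cases}$$
   Context: For a prime $p$ write ${\mathbf{\,e}}_p(x)=e^{2\pi i x/p}$. For positive integers $m,n$ let $$M_{m,n}=\max_{\substack{a,b\in\mathbb Z\\ \gcd(ab,\,p)=1}}\left|\sum_{x=0}^{p-1}{\mathbf{\,e}}_p(ax^{m}+bx^{n})\right|.$$ The notation $A\lesssim B$ means $A\le p^{o(1)}B$ as $p\to\infty$ (the $o(1)$ term tending to $0$ as $p\to\infty$, uniformly in the other parameters). *)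

(* Defs.v *)
From HB Require Import structures.
From mathcomp Require Import all_boot all_order all_algebra.
From mathcomp Require Import complex.
From mathcomp Require Import all_classical all_reals all_analysis.

Set Implicit Arguments.
Unset Strict Implicit.
Unset Printing Implicit Defensive.

Import Order.TTheory GRing.Theory Num.Theory.
Import numFieldNormedType.Exports.
Import ComplexField.

Local Open Scope classical_set_scope.
Local Open Scope ring_scope.
Local Open Scope complex_scope.

(* e^{it}; the libraries have no exponential of a complex argument. *)
Definition expi (R : realType) (t : R) : R[i] := cos t +i* sin t.

Definition ep (R : realType) (p : nat) (x : int) : R[i] :=
  expi (2 * pi * x%:~R / p%:R).

Definition binomial_sum (R : realType) (p m n : nat) (a b : int) : R[i] :=
  \sum_(0 <= x < p) ep R p (a * x%:Z ^+ m + b * x%:Z ^+ n).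

(* The index set of pairs (a, b) is infinite, hence a supremum; by
   [Mmax_is_max] it is attained when p is prime. [normc] is the R-valued
   modulus, whereas `|z| would lie in R[i]. *)
Definition Mmax (R : realType) (p m n : nat) : R :=
  sup [set r : R | exists a b : int,
         coprimez (a * b) p%:Z /\ r = Normc.normc (binomial_sum R p m n a b)].

Lemma expi_period (R : realType) (t : R) (k : int) :
  expi (t + k%:~R * (2 * pi)) = expi t.
Proof.
have E (s : R) (j : nat) : expi (s + j%:R * (2 * pi)) = expi s.
  rewrite /expi; elim: j => [|j IH]; first by rewrite mul0r addr0.
  rewrite -[in RHS]IH -natr1 mulrDl mul1r addrA.
  have -> : 2 * pi = pi *+ 2 :> R by rewrite mulr_natl.
  by rewrite cosD2pi sinD2pi.
case: k => j; first exact: E.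
by rewrite -[in RHS](subrK (j.+1%:R * (2 * pi)) t) E NegzE mulrNz mulNr.
Qed.

Lemma ep_modz (R : realType) (p : nat) (x y : int) : (0 < p)%N ->
  (x = y %[mod p%:Z])%Z -> ep R p x = ep R p y.
Proof.
move=> p0 /eqP; rewrite eqz_mod_dvd => /dvdzP[k xy].
have -> : x = y + k * p%:Z by rewrite -xy addrC subrK.
have p0' : p%:R != 0 :> R by rewrite pnatr_eq0 -lt0n.
rewrite /ep -(expi_period (2 * pi * y%:~R / p%:R) k); congr expi.
rewrite intrD intrM mulrDr mulrDl; congr (_ + _).
by rewrite -[_%:Z%:~R]/(p%:R) !mulrA mulfK// mulrC mulrA.
Qed.

Lemma binomial_sum_modz (R : realType) (p m n : nat) (a b : int) :
  (0 < p)%N ->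
  binomial_sum R p m n a b = binomial_sum R p m n (a %% p)%Z (b %% p)%Z.
Proof.
move=> p0; apply: eq_bigr => x _; apply: ep_modz => //.
by rewrite -modzDm -[in RHS]modzDm !modzMml.
Qed.

Lemma Mmax_is_max (R : realType) (p m n : nat) : prime p ->
  (exists a b : int, coprimez (a * b) p%:Z /\
     Mmax R p m n = Normc.normc (binomial_sum R p m n a b)) /\
  (forall a b : int, coprimez (a * b) p%:Z ->
     Normc.normc (binomial_sum R p m n a b) <= Mmax R p m n).
Proof.
move=> pp; have p0 := prime_gt0 pp.
pose F (u : 'I_p * 'I_p) : R :=
  Normc.normc (binomial_sum R p m n (u.1 : nat)%:Z (u.2 : nat)%:Z).
pose P (u : 'I_p * 'I_p) := coprimez ((u.1 : nat)%:Z * (u.2 : nat)%:Z) p%:Z.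
have P1 : P (Ordinal (prime_gt1 pp), Ordinal (prime_gt1 pp)).
  by rewrite /P/= mulr1 /coprimez gcd1z.
case: (@arg_maxP _ R _ _ P F P1) => u Pu Fu.
set S := [set r : R | exists a b : int,
  coprimez (a * b) p%:Z /\ r = Normc.normc (binomial_sum R p m n a b)].
have uS : S (F u) by exists (u.1 : nat)%:Z, (u.2 : nat)%:Z.
have ubS : ubound S (F u).
  move=> _ [a [b [cab ->]]].
  have ord (c : int) : exists i : 'I_p, (i : nat)%:Z = (c %% p)%Z.
    have pz : p%:Z != 0 by rewrite eqz_nat -lt0n.
    have := modz_ge0 c pz; have := ltz_pmod c (p0 : 0 < p%:Z).
    by case: (c %% p)%Z => // k kp _; exists (Ordinal (kp : (k < p)%N)).
  have [i ia] := ord a; have [j jb] := ord b.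
  rewrite binomial_sum_modz// -ia -jb; apply: (Fu (i, j)).
  by rewrite /P/= ia jb /coprimez -gcdz_modl modzMm gcdz_modl.
have -> : Mmax R p m n = F u.
  apply/eqP; rewrite eq_le; apply/andP; split.
    by apply: ge_sup => //; exists (F u).
  by apply: ub_le_sup => //; exists (F u).
split; last by move=> a b ab; apply: ubS; exists a, b.
by case: uS => a [b [ab Fab]]; exists a, b.
Qed.

(* Main.v *)
(* Since n divides p - 1 and gcd(m, n) = 1, replacing x by u x with u in the
   group G of n-th roots of unity and averaging over u gives
   n S = sum_x e(b x^n) T(a x^m), where T(l) = sum_(u in G) e(l u).
   Hoelder's inequality and Parseval's identity then give
   (n |S|)^4 <= h p^4 E(G), with E(G) the additive energy of G, and everything
   follows from E(G) <= p^o(1) (n^(22/9) + n^3 p^(-1/3)) for n <= p^(2/3).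

   Let r be the representation function of G - G, P = {r >= t} a popular level
   set and B = {b in G : 1 - b in P}.  A spectral inequality gives
   |B|^2 E(G) <= n^2 sum_(b, c in B) r(b - c).  The right-hand side is bounded
   through the classes (x^n, (1 - x)^n) of the ratios x = (1 - b) / (1 - c):
   by Stepanov's method, #{s : class s has at least t elements} = O(n^2 / t^3)
   as soon as t exceeds a multiple of 1 + n^2 / p, so that the third moment of
   the class sizes is n^2 up to a logarithm.  Ratios in large classes are
   treated by this third moment; those in small classes by the Cauchy-Schwarz
   inequality and the third energy sum_x r(x)^3, which is n^3 up to a
   logarithm. *)
Require Import Defs.
From HB Require Import structures.
From mathcomp Require Import all_classical all_reals all_analysis.
From mathcomp Require Import all_boot all_order all_algebra finfield.
From mathcomp Require Import complex.
From mathcomp Require Import zify ring lra.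

Set Implicit Arguments.
Unset Strict Implicit.
Unset Printing Implicit Defensive.

Import Order.TTheory GRing.Theory Num.Theory.
Import numFieldNormedType.Exports.

Local Open Scope ring_scope.

(** * Stepanov's method *)

(** The bounds t^3 |P| = O(n^3) and t |P| <= n^2 alone give only n^(5/2) for the energy, the loss
    being at levels t near n^(1/2). For the mass m = t^2 |P| of a level, the ratios in large classes
    yield m^6 |P| <= n^16 up to logarithms, which is strong when P is large, while the bound on |P|
    yields m^3 <= n^6 |P|, which is strong when P is small. The product m^9 <= n^22 is free of |P|
    and is the origin of the exponent 22/9. The term n^3 p^(-1/3) has another source. For vanishing
    order A, Stepanov's auxiliary polynomial has degree of order n^2 / A, and this must not exceed
    the order of p. The method thus says nothing below T = [threshold p n], of size 1 + n^2 / p.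
    Ratios in classes with fewer than T elements are counted crudely, at the price m^3 <= n^7 T up
    to logarithms, that is n^(7/3) + n^3 p^(-1/3). *)

Lemma exists_kernel_vector (F : fieldType) (I J : finType) (f : I -> J -> F) :
  (#|J| < #|I|)%N ->
  exists2 l : I -> F, (exists i, l i != 0) & forall j, \sum_i l i * f i j = 0.
Proof.
move=> JI.
pose M := \matrix_(i < #|I|, j < #|J|) f (enum_val i) (enum_val j).
have kM : kermx M != 0.
  by rewrite -mxrank_eq0 mxrank_ker subn_eq0 -ltnNge (leq_ltn_trans (rank_leq_col _)).
have [v /sub_kermxP vM v0] := rowV0Pn kM.
exists (fun i => v 0 (enum_rank i)) => [|j].
  have /rV0Pn [i vi] := v0.
  by exists (enum_val i); rewrite enum_valK.
rewrite (reindex (@enum_val I xpredT)) /=; last by apply: onW_bij; exact: enum_val_bij.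
have /matrixP /(_ 0 (enum_rank j)) := vM.
rewrite !mxE => vj; rewrite -[RHS]vj; apply: eq_bigr => i _.
by rewrite mxE !enum_valK enum_rankK.
Qed.

Lemma natr_inj_pchar (F : fieldType) (p i j : nat) :
  p \in [pchar F] -> (i < p)%N -> (j < p)%N -> i%:R = j%:R :> F -> i = j.
Proof.
move=> charp; wlog ij : i j / (i <= j)%N => [W|] ip jp e.
  by have [ij|/ltnW ij] := leqP i j; [exact: W|symmetry; exact: W].
have : (p %| j - i)%N by rewrite (dvdn_pcharf charp) natrB // e subrr.
by move=> /dvdn_leq; lia.
Qed.

(* The operator f |-> X f' - e f kills the term of degree e and lowers the
   order of vanishing at 1 by one only. *)
Lemma fewnomial_eq0 (F : fieldType) (p r : nat) (f : {poly F}) (I : {set 'I_p}) :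
  p \in [pchar F] -> (size f <= p)%N ->
  (forall i : 'I_p, f`_i != 0 -> i \in I) -> (#|I| <= r)%N ->
  ('X - 1%:P) ^+ r %| f -> f = 0.
Proof.
move=> charp.
have coef_out (g : {poly F}) (i : nat) : (size g <= p)%N -> (p <= i)%N -> g`_i = 0.
  by move=> sg pi; rewrite nth_default // (leq_trans sg).
elim: r f I => [|r IH] f I sf fI Ir dvd.
  apply/polyP => i; rewrite coef0.
  have [ip|/(coef_out _ _ sf)->//] := ltnP i p.
  apply/eqP; apply: contraTT Ir => fi; rewrite -ltnNge card_gt0.
  by apply/set0Pn; exists (Ordinal ip); exact: fI.
have [//|fN0] := eqVneq f 0.
have [e fe] : exists e : 'I_p, f`_e != 0.
  have lt : ((size f).-1 < p)%N by rewrite prednK // size_poly_gt0.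
  by exists (Ordinal lt); rewrite -lead_coefE lead_coef_eq0.
pose g := 'X * f^`() - f *+ e.
have cg (i : nat) : g`_i = f`_i * (i%:R - e%:R).
  rewrite coefB coefXM coefMn mulrBr !mulr_natr.
  by case: i => [|i] //=; rewrite ?mulr0n // coef_deriv.
have g0 : g = 0.
  apply: (IH g (I :\ e)).
  - apply/leq_sizeP => j pj; rewrite cg coef_out ?mul0r //.
  - move=> i; rewrite cg mulf_eq0 negb_or => /andP[fi ie].
    by rewrite !inE fI // andbT; apply: contraNneq ie => ->; rewrite subrr.
  - by move: Ir; rewrite (cardsD1 e) (fI _ fe).
  - rewrite dvdp_sub //; last first.
      by rewrite -mulr_natl dvdp_mull // (dvdp_trans _ dvd) // exprS dvdp_mull.
    have /dvdpP [q ->] := dvd; rewrite dvdp_mull // derivM dvdp_add //.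
      by rewrite dvdp_mull // exprS dvdp_mull.
    by rewrite dvdp_mull // deriv_exp /= -mulr_natl !dvdp_mull.
(* Exponents below p are distinct in F, so [g = 0] leaves only the term of degree e, and a nonzero
   monomial does not vanish at 1. *)
have fE : f = f`_e *: 'X^e.
  apply/polyP => i; rewrite coefZ coefXn.
  have [->|ie] := eqVneq; first by rewrite mulr1.
  rewrite mulr0.
  have [ip|/(coef_out _ _ sf)->//] := ltnP i p.
  have /eqP := cg i; rewrite g0 coef0 eq_sym mulf_eq0 => /orP[/eqP//|].
  rewrite subr_eq0 => /eqP /(natr_inj_pchar charp ip (ltn_ord e)) ie'.
  by rewrite ie' eqxx in ie.
move: dvd; rewrite fE dvdpZr // exprS => /(dvdp_trans (dvdp_mulr _ (dvdpp _))).
rewrite dvdp_XsubCl rootE hornerXn expr1n oner_eq0 //.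
Qed.

Lemma mul_size_multiroots_lt (F : fieldType) (rs : seq F) (A : nat) (q : {poly F}) :
  q != 0 -> uniq rs -> (forall x, x \in rs -> ('X - x%:P) ^+ A %| q) ->
  (A * size rs < size q)%N.
Proof.
move=> q0 urs dvd.
suff D : \prod_(x <- rs) ('X - x%:P) ^+ A %| q.
  have := dvdp_leq q0 D; rewrite prodrXl.
  have := size_exp (\prod_(x <- rs) ('X - x%:P)) A.
  rewrite size_prod_XsubC /= mulnC => <-; apply: leq_trans.
  by rewrite prednK // size_poly_gt0 expf_neq0 // monic_neq0 // monic_prod_XsubC.
elim: rs urs dvd => [|x rs IH] /=; first by rewrite big_nil dvd1p.
move=> /andP[xrs urs] dvd.
rewrite big_cons Gauss_dvdp ?dvd ?mem_head ?IH //.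
  by move=> y yrs; apply: dvd; rewrite inE yrs orbT.
rewrite big_seq coprimep_expl //; elim/big_rec: _ => [|y f yrs cf].
  by rewrite coprimep1.
rewrite coprimepMr cf andbT coprimep_expr // coprimep_XsubC2 //.
by rewrite subr_eq0; apply: contraNneq xrs => <-.
Qed.

(** Taylor coefficients replace derivatives, which lose information once the order reaches the
    characteristic. The scale [u] is free; it will be [x * (1 - x)], which keeps the coefficients
    polynomial in [x], of low degree. *)
Lemma taylor_XsubC_dvdp (F : fieldType) (x u : F) (f : {poly F}) (A : nat) :
  u != 0 -> (forall j, (j < A)%N -> (f \Po (x%:P + u%:P * 'X))`_j = 0) ->
  ('X - x%:P) ^+ A %| f.
Proof.
move=> u0 fj.
have dvd : 'X^A %| f \Po (x%:P + u%:P * 'X).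
  rewrite -(poly_take_drop A (f \Po _)) dvdp_addl ?dvdp_mull //.
  suff -> : take_poly A (f \Po (x%:P + u%:P * 'X)) = 0 by rewrite dvdp0.
  by apply/polyP => j; rewrite coef_take_poly coef0; case: ifP => // /fj.
have := dvdp_comp_poly (u^-1%:P * ('X - x%:P)) dvd.
rewrite -comp_polyA comp_polyD comp_polyC comp_polyM comp_polyC comp_polyX.
rewrite mulrA -polyCM divff // mul1r subrKC comp_polyXr.
rewrite rmorphXn /= comp_polyX exprMn => /(dvdp_trans _) -> //.
by rewrite dvdp_mull.
Qed.

(** X^(nb) and (1 - X)^(nc) are constant on a class, so that of the whole degree only [a] weighs in
    the vanishing conditions. *)
Definition stepanov_monomial (F : comNzRingType) (n a b c : nat) : {poly F} :=
  'X^(a + n * b) * (1 - 'X) ^+ (n * c).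

(* After the substitution X = x + x (1 - x) W, the monomial above is
   x^(nb) (1 - x)^(nc) times the value at x of this polynomial in W, whose
   coefficient of W^j has degree at most a + j in x. *)
Definition stepanov_taylor (F : comNzRingType) (n a b c : nat) : {poly {poly F}} :=
  ('X^a)%:P * (1 + (1 - 'X)%:P * 'X) ^+ (a + n * b) * (1 - 'X%:P * 'X) ^+ (n * c).

Lemma stepanov_taylorE (F : comNzRingType) (n a b c : nat) (x : F) :
  stepanov_monomial F n a b c \Po (x%:P + (x * (1 - x))%:P * 'X) =
  ((x ^+ n) ^+ b * ((1 - x) ^+ n) ^+ c) *:
     map_poly (horner_eval x) (stepanov_taylor F n a b c).
Proof.
have s1 : x%:P + (x * (1 - x))%:P * 'X = x%:P * (1 + (1 - x)%:P * 'X).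
  by rewrite !(polyCM, polyCB); ring.
have s2 : 1 - (x%:P + (x * (1 - x))%:P * 'X) = (1 - x)%:P * (1 - x%:P * 'X).
  by rewrite !(polyCM, polyCB); ring.
rewrite /stepanov_monomial /stepanov_taylor.
rewrite comp_polyM !rmorphXn /= rmorphB /= comp_polyX comp_polyC s2 s1.
set ev := map_poly _.
have evM f g : ev (f * g) = ev f * ev g by exact: rmorphM.
have evD f g : ev (f + g) = ev f + ev g by exact: rmorphD.
have evN f : ev (- f) = - ev f by exact: rmorphN.
have evXn f m : ev (f ^+ m) = ev f ^+ m by exact: rmorphXn.
have ev1 : ev 1 = 1 by exact: rmorph1.
have evC f : ev f%:P = f.[x]%:P by rewrite /ev map_polyC.
have evX : ev 'X = 'X by rewrite /ev map_polyX.
rewrite !(evM, evXn, evD, evN, ev1, evC, evX) !hornerE -mul_polyC polyCM !exprMn.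
rewrite !(rmorphXn polyC) /= !exprD !exprM.
ring.
Qed.

Lemma size_coef_mul_le (F : comNzRingType) (k l : nat) (f g : {poly {poly F}}) :
  (forall j, size (f`_j)%R <= k + j.+1)%N -> (forall j, size (g`_j)%R <= l + j.+1)%N ->
  forall j, (size ((f * g)`_j)%R <= k + l + j.+1)%N.
Proof.
move=> sf sg j; rewrite coefM (leq_trans (size_sum _ _ _)) //.
apply/bigmax_leqP => i _; apply: leq_trans (size_polyMleq _ _) _.
by have := sf i; have := sg (j - i)%N; have := ltn_ord i; lia.
Qed.

Lemma size_coef_stepanov_taylor (F : comNzRingType) (n a b c j : nat) :
  (size ((stepanov_taylor F n a b c)`_j)%R <= a + j.+1)%N.
Proof.
have szX (f : {poly {poly F}}) (m : nat) : (forall j, size (f`_j)%R <= 0 + j.+1)%N ->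
    (forall j, size ((f ^+ m)`_j)%R <= 0 + j.+1)%N.
  move=> sf; elim: m => [|m IH] i; last by rewrite exprS; exact: (@size_coef_mul_le _ 0 0).
  by rewrite expr0 coef1; case: i => [|i] /=; rewrite ?size_polyC ?size_poly0 //; case: (_ != _).
have -> : (a + j.+1 = a + 0 + 0 + j.+1)%N by rewrite !addn0.
apply: (@size_coef_mul_le _ (a + 0) 0) => {}j; last first.
  move: j;apply: szX => i; rewrite coefB coef1 coefMX coefC.
  case: i => [|[|i]] /=; rewrite ?subr0 ?sub0r ?size_polyN ?size_polyX ?size_poly1 //.
  by rewrite ?oppr0 ?size_poly0.
move: j; apply: (@size_coef_mul_le _ a 0).
  move=> i; rewrite coefC; case: i => [|i] /=; rewrite ?size_polyXn ?size_poly0 //.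
  by rewrite addn1.
apply: szX => i; rewrite coefD coef1 coefMX coefC.
case: i => [|[|i]] /=; rewrite ?addr0 ?add0r ?size_poly1 ?size_poly0 //.
by rewrite -size_polyN opprB size_XsubC.
Qed.

(** The term c = 0 is divisible by (1 - X)^n because all the others are, so it vanishes; dividing by
    (1 - X)^n shifts the sum, and the argument repeats. *)
Lemma sum_1subX_exp_eq0 (F : fieldType) (n B : nat) (f : nat -> {poly F}) :
  (forall c, (c < B)%N -> (1 - 'X) ^+ n %| f c -> f c = 0) ->
  \sum_(c < B) (1 - 'X) ^+ (n * c) * f c = 0 ->
  forall c, (c < B)%N -> f c = 0.
Proof.
elim: B f => [//|B IH] f fdvd; rewrite big_ord_recl muln0 expr0 mul1r.
have -> : \sum_(i < B) (1 - 'X) ^+ (n * bump 0 i) * f (bump 0 i) =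
    (1 - 'X) ^+ n * \sum_(i < B) (1 - 'X) ^+ (n * i) * f i.+1.
  rewrite mulr_sumr; apply: eq_bigr => i _.
  by rewrite /bump leq0n add1n mulnS exprD mulrA.
move=> sum0.
have f0 : f 0 = 0.
  apply: fdvd => //; move/eqP: sum0; rewrite addr_eq0 => /eqP ->.
  by rewrite dvdpNr dvdp_mulr.
move: sum0; rewrite f0 add0r => /eqP; rewrite mulf_eq0 expf_eq0.
have -> : (1 - 'X == 0 :> {poly F}) = false.
  by rewrite subr_eq0 eq_sym; apply/negbTE; rewrite -subr_eq0 polyXsubC_eq0.
rewrite andbF /= => /eqP sum0 [//|c] cB.
by apply: (IH (f \o succn)) => // {}c {}cB; apply: fdvd.
Qed.

Definition cls (F : comNzRingType) (n : nat) (x : F) : F * F :=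
  (x ^+ n, (1 - x) ^+ n).

Definition cls_preim (F : finFieldType) (n : nat) (S : {set F * F}) : {set F} :=
  [set x | [&& x != 0, x != 1 & cls n x \in S]].

(** Grouped by [c], the factor of (1 - X)^(nc) has at most AB <= n terms, all of degree below p, so
    [fewnomial_eq0] forbids its divisibility by (1 - X)^n unless it is zero. Since A <= n, the
    exponents a + nb are distinct and no two terms merge. *)
Lemma stepanov_nonzero (F : fieldType) (p n A B : nat)
    (l : 'I_A * 'I_B * 'I_B -> F) :
  p \in [pchar F] -> (A * B <= n)%N -> (n * B <= p)%N -> (exists i, l i != 0) ->
  \sum_i l i *: stepanov_monomial F n i.1.1 i.1.2 i.2 != 0.
Proof.
move=> charp AB nB [[[a0 b0] c0] l0].
have An : (A <= n)%N.
  by apply: leq_trans AB; rewrite leq_pmulr // (leq_trans _ (ltn_ord b0)).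
have lt_exp (a : 'I_A) (b : 'I_B) : (a + n * b < p)%N.
  apply: leq_trans nB; have := ltn_ord a; have := ltn_ord b; nia.
pose f (c : nat) : {poly F} :=
  \sum_(ab : 'I_A * 'I_B)
    (if insub c is Some c' then l (ab, c') else 0) *: 'X^(ab.1 + n * ab.2).
have fE (c : 'I_B) : f c = \sum_(ab : 'I_A * 'I_B) l (ab, c) *: 'X^(ab.1 + n * ab.2).
  by apply: eq_bigr => ab _; rewrite valK.
have coef_f (a : 'I_A) (b c : 'I_B) : (f c)`_(a + n * b) = l (a, b, c).
  rewrite fE coef_sum (bigD1 (a, b)) //= coefZ coefXn eqxx mulr1.
  rewrite big1 ?addr0 // => -[a' b'] /= neq; rewrite coefZ coefXn.
  case: eqP => [e|]; rewrite ?mulr0 //; case/negP: neq.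
  have lta := ltn_ord a; have lta' := ltn_ord a'.
  have eb : b = b' :> nat.
    move: e; case: (ltngtP b b') => //; nia.
  have ea : a = a' :> nat by move: e; rewrite eb; lia.
  by apply/eqP; congr (_, _); apply: val_inj.
have f_zero c : (c < B)%N -> (1 - 'X) ^+ n %| f c -> f c = 0.
  move=> cB dvd; pose c' := Ordinal cB; rewrite -[c]/(nat_of_ord c') in dvd *.
  pose I := [set Ordinal (lt_exp ab.1 ab.2) | ab in [set: 'I_A * 'I_B]].
  apply: (@fewnomial_eq0 _ p n _ I charp).
  - apply/leq_sizeP => j pj; rewrite fE coef_sum big1 // => -[a b] _.
    rewrite coefZ coefXn; case: eqP => [e|]; rewrite ?mulr0 //.
    by have := lt_exp a b; rewrite -e ltnNge pj.
  - move=> i; rewrite fE coef_sum; apply: contraNT => iI; rewrite big1 // => ab _.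
    rewrite coefZ coefXn; case: eqP => [e|]; rewrite ?mulr0 //; case/negP: iI.
    by apply/imsetP; exists ab; rewrite ?inE //; apply: val_inj.
  - apply: leq_trans (leq_imset_card _ _) _.
    by rewrite cardsT card_prod !card_ord.
  - suff -> : ('X - 1%:P) ^+ n %| f c' = ((1 - 'X) ^+ n %| f c') by [].
    by rewrite -opprB exprNn -signr_odd mulr_sign; case: odd; rewrite ?dvdpNl.
apply/eqP => sum0; case/eqP: l0; rewrite -coef_f.
rewrite (sum_1subX_exp_eq0 f_zero _ (ltn_ord c0)) ?coef0 //.
rewrite -[RHS]sum0.
rewrite [RHS](eq_bigr (fun i => l (i.1, i.2) *: stepanov_monomial F n i.1.1 i.1.2 i.2));
  last by case.
rewrite -(pair_bigA _ (fun ab c => l (ab, c) *: stepanov_monomial F n ab.1 ab.2 c)).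
rewrite [RHS]exchange_big /=; apply: eq_bigr => c _.
rewrite fE mulr_sumr; apply: eq_bigr => ab _.
by rewrite /stepanov_monomial -scalerAr mulrC.
Qed.

Lemma stepanov (F : finFieldType) (p n A B : nat) (S : {set F * F}) :
  p \in [pchar F] -> (A * B <= n)%N -> (n * B <= p)%N ->
  (2 * #|S| * A < B ^ 2)%N -> (A * #|cls_preim n S| <= A + 2 * n * B)%N.
Proof.
move=> charp AB nB SAB.
have [->|A0] := posnP A; first by rewrite mul0n.
pose I : finType := ('I_A * 'I_B * 'I_B)%type.
(* One equation for each class, each order j < A and each coefficient k < 2A, because the Taylor
   coefficient of order j has size at most a + j + 1 < 2A: in all 2 |S| A^2 equations for A B^2
   unknowns. *)
pose J : finType := ({s : F * F | s \in S} * 'I_A * 'I_(2 * A))%type.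
have cJI : (#|{: J}| < #|{: I}|)%N.
  rewrite !card_prod !card_ord card_sig -[#|_|]/#|S|.
  have -> : (#|S| * A * (2 * A) = A * (2 * #|S| * A))%N by ring.
  by rewrite -[X in (_ < X)%N]mulnA mulnn ltn_pmul2l.
pose Q (i : I) := stepanov_taylor F n i.1.1 i.1.2 i.2.
have [l l0 lker] := exists_kernel_vector
  (fun (i : I) (j : J) => (val j.1.1).1 ^+ i.1.2 * (val j.1.1).2 ^+ i.2 *
                          ((Q i)`_j.1.2)`_j.2) cJI.
pose f := \sum_i l i *: stepanov_monomial F n i.1.1 i.1.2 i.2.
have f0 : f != 0 by exact: (stepanov_nonzero charp AB nB l0).
have sf : (size f <= A + 2 * n * B)%N.
  apply: (leq_trans (size_sum _ _ _)); apply/bigmax_leqP => -[[a b] c] _ /=.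
  apply: (leq_trans (size_scale_leq _ _)).
  rewrite /stepanov_monomial; apply: (leq_trans (size_polyMleq _ _)); rewrite size_polyXn.
  have := size_exp (1 - 'X : {poly F}) (n * c).
  rewrite -(size_polyN (1 - 'X)) opprB size_XsubC /=.
  have := ltn_ord a; have := ltn_ord b; have := ltn_ord c.
  by move: (size ((1 - 'X : {poly F}) ^+ _)) => m; nia.
have dvd x : x \in enum (cls_preim n S) -> ('X - x%:P) ^+ A %| f.
  rewrite mem_enum inE => /and3P[x0 x1 xS].
  have u0 : x * (1 - x) != 0 by rewrite mulf_neq0 // subr_eq0 eq_sym.
  apply: (taylor_XsubC_dvdp u0) => j jA.
  have -> : f \Po (x%:P + (x * (1 - x))%:P * 'X) =
      \sum_i (l i * ((x ^+ n) ^+ i.1.2 * ((1 - x) ^+ n) ^+ i.2)) *: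
         map_poly (horner_eval x) (Q i).
    rewrite linear_sum; apply: eq_bigr => i _.
    by rewrite /= comp_polyZ stepanov_taylorE scalerA.
  pose g := \sum_i (l i * ((x ^+ n) ^+ i.1.2 * ((1 - x) ^+ n) ^+ i.2)) *: (Q i)`_j.
  have -> : (\sum_i (l i * ((x ^+ n) ^+ i.1.2 * ((1 - x) ^+ n) ^+ i.2)) *:
         map_poly (horner_eval x) (Q i))`_j = g.[x].
    rewrite coef_sum horner_sum; apply: eq_bigr => i _.
    by rewrite coefZ hornerZ coef_map.
  suff -> : g = 0 by rewrite horner0.
  apply/polyP => k; rewrite coef0 coef_sum.
  have [k2A|kA] := ltnP k (2 * A).
    pose s : {s : F * F | s \in S} := exist _ (cls n x) xS.
    rewrite -[RHS](lker (s, Ordinal jA, Ordinal k2A)).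
    by apply: eq_bigr => i _; rewrite coefZ -[LHS]mulrA.
  apply: big1 => i _; rewrite coefZ (nth_default _ (leq_trans _ kA)) ?mulr0 //.
  apply: (leq_trans (size_coef_stepanov_taylor _ _ _ _ _ _)).
  by have := ltn_ord i.1.1; lia.
have := mul_size_multiroots_lt f0 (enum_uniq _) dvd.
by rewrite -cardE => /ltnW /leq_trans; apply.
Qed.

(** * Sizes of the classes *)

Definition cls_mult (F : finFieldType) (n : nat) (s : F * F) : nat :=
  #|cls_preim n [set s]|.

Lemma card_cls_preim (F : finFieldType) (n : nat) (S : {set F * F}) :
  #|cls_preim n S| = (\sum_(s in S) cls_mult n s)%N.
Proof.
rewrite -sum1_card (partition_big (cls n) (mem S)) /=; last first.
  by move=> x; rewrite inE => /and3P[].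
apply: eq_bigr => s sS; rewrite /cls_mult -sum1_card; apply: eq_bigl => x.
rewrite !inE; have [->|_] := eqVneq (cls n x) s; by rewrite ?sS ?andbT ?andbF.
Qed.

Lemma card_expr_eq_le (F : finFieldType) (n : nat) (y : F) : (0 < n)%N ->
  (#|[set x : F | x ^+ n == y]| <= n)%N.
Proof.
move=> n0; have sz : size ('X^n - y%:P) = n.+1 by rewrite size_XnsubC.
have := @max_poly_roots _ ('X^n - y%:P) (enum [set x : F | x ^+ n == y]).
rewrite -size_poly_eq0 sz enum_uniq -cardE ltnS; apply => //.
apply/allP => x; rewrite mem_enum inE => /eqP xy.
by rewrite rootE !hornerE xy subrr.
Qed.

Lemma cls_mult_le (F : finFieldType) (n : nat) (s : F * F) : (0 < n)%N ->
  (cls_mult n s <= n)%N.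
Proof.
move=> n0; apply: leq_trans (card_expr_eq_le s.1 n0); apply: subset_leq_card.
by apply/subsetP => x; rewrite !inE => /and3P[_ _ /eqP <-].
Qed.

(** Here B = n %/ A is the largest value with AB <= n. Rounding costs n <= 2AB, which turns the
    condition 2 |S| A < B^2 into 8 |S| A^3 < n^2; the 3 comes from A (A + 2nB) <= n^2 + 2 n^2. *)
Lemma stepanov_popular (F : finFieldType) (p n A t : nat) (S : {set F * F}) :
  p \in [pchar F] -> (0 < A)%N -> (A <= n)%N -> (n ^ 2 <= A * p)%N ->
  (8 * #|S| * A ^ 3 < n ^ 2)%N -> (forall s, s \in S -> (t <= cls_mult n s)%N) ->
  (t * #|S| * A ^ 2 <= 3 * n ^ 2)%N.
Proof.
move=> charp A0 An nAp kA tS; set B := (n %/ A)%N.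
have AB : (A * B <= n)%N by rewrite mulnC leq_trunc_div.
have nAB : (n < A * B.+1)%N by rewrite mulnC ltn_ceil.
have B0 : (0 < B)%N by rewrite divn_gt0.
have nB : (n * B <= p)%N.
  have : (A * (n * B) <= A * p)%N by apply: leq_trans nAp; rewrite mulnCA -mulnn leq_mul2l AB orbT.
  by rewrite leq_pmul2l.
have SAB : (2 * #|S| * A < B ^ 2)%N.
  have h : (A ^ 2 * 4 * (2 * #|S| * A) < A ^ 2 * 4 * B ^ 2)%N.
    have e1 : (A ^ 2 * 4 * (2 * #|S| * A) = 8 * #|S| * A ^ 3)%N by ring.
    have e2 : (A ^ 2 * 4 * B ^ 2 = (2 * (A * B)) ^ 2)%N by ring.
    rewrite e1 e2; apply: (leq_trans kA); rewrite leq_exp2r //.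
    by have := leq_pmulr A B0; move: nAB; rewrite mulnS; move: (A * B)%N; lia.
  by move: h; rewrite ltn_mul2l => /andP[].
have tZ : (t * #|S| <= #|cls_preim n S|)%N.
  rewrite card_cls_preim mulnC -sum_nat_const; exact: leq_sum.
have := stepanov charp AB nB SAB; move: tZ; move: #|cls_preim n S| => Z tZ AZ.
have : (A * (t * #|S|) <= A + 2 * n * B)%N by apply: leq_trans AZ; rewrite leq_mul2l tZ orbT.
move=> h; have : (A * (A * (t * #|S|)) <= A * (A + 2 * n * B))%N by rewrite leq_mul2l h orbT.
have -> : (A * (A * (t * #|S|)) = t * #|S| * A ^ 2)%N by ring.
by move=> /leq_trans; apply; nia.
Qed.

(* The factor 225 makes t >= threshold p n vacuous unless n is large enough for
   the choice of parameters in [card_popular_classes]. *)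
Definition threshold (p n : nat) : nat := (225 * (n ^ 2 %/ p).+1)%N.

Lemma sqr_divn_le (p n : nat) : (0 < p)%N -> (n ^ 3 <= p ^ 2)%N ->
  ((n ^ 2 %/ p) ^ 2 <= n)%N.
Proof.
move=> p0 np; set q := (n ^ 2 %/ p)%N.
have h : (q * p <= n ^ 2)%N by rewrite leq_trunc_div.
have : (q ^ 2 * p ^ 2 <= n * p ^ 2)%N.
  apply: (@leq_trans (n * n ^ 3)); last by rewrite leq_mul2l np orbT.
  by rewrite -expnMn -expnS -[(n ^ 4)%N]/(n ^ (2 * 2))%N expnM leq_exp2r.
by rewrite leq_pmul2r // expn_gt0 p0.
Qed.

(** With k classes, the best choice is the largest A with 8 k A^3 < n^2. Then A^3 >= n^2 / (64 k),
    and cubing t k A^2 <= 3 n^2 produces the constant 4^6 * 3^3 = 48^3. If k is so large that A = q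
    + 1 is already excluded, a subfamily contradicts the lower bound on t. *)
Lemma card_popular_classes (F : finFieldType) (p n t : nat) :
  p \in [pchar F] -> (0 < n)%N -> (n ^ 3 <= p ^ 2)%N -> (threshold p n <= t)%N ->
  (t ^ 3 * #|[set s : F * F | t <= cls_mult n s]| <= 48 ^ 3 * n ^ 2)%N.
Proof.
move=> charp n0 np; rewrite /threshold; set q := (n ^ 2 %/ p)%N => tq.
set S := [set s | _]; set k := #|S|.
have [->|k0] := posnP k; first by rewrite muln0.
have p0 : (0 < p)%N by rewrite prime_gt0 // (pcharf_prime charp).
have n225 : (225 <= n)%N.
  move: k0; rewrite card_gt0 => /set0Pn[s]; rewrite inE => ts.
  by have := cls_mult_le s n0; lia.
have q2 : (q ^ 2 <= n)%N by exact: sqr_divn_le.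
(* The constant 225 = 15^2 enters here. If q <= 14, then (q + 1)^2 <= 225 <= n and 8 (q + 1) <= 120
   < n; if q >= 15, then q^4 <= n^2 and 8 (16/15)^3 < 15 conclude. *)
have q3 : (8 * q.+1 ^ 3 < n ^ 2)%N.
  have [q14|q15] := leqP q 14.
    apply: (@leq_trans (n * q.+1 ^ 2)).
      by rewrite (expnS _ 2) mulnA ltn_pmul2r ?expn_gt0 //; lia.
    rewrite -mulnn leq_mul2l; apply/orP; right.
    by apply: (@leq_trans (15 * 15)); rewrite -?mulnn ?leq_mul //; lia.
  apply: (@leq_trans (q ^ 2 * q ^ 2)); last by rewrite -mulnn leq_mul.
  have : (15 * q.+1 <= 16 * q)%N by lia.
  rewrite -(@leq_exp2r _ _ 3) // !expnMn => h.
  have : (15 * q ^ 3 <= q * q ^ 3)%N by rewrite leq_mul2r q15 orbT.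
  have e : (q ^ 2 * q ^ 2 = q * q ^ 3)%N by ring.
  have : (0 < q ^ 3)%N by rewrite expn_gt0; lia.
  by rewrite e; lia.
have nqp (A : nat) : (q < A)%N -> (n ^ 2 <= A * p)%N.
  by move=> qA; rewrite (leq_trans (ltnW (ltn_ceil _ p0))) // leq_mul2r qA orbT.
have [kq|kq] := ltnP (8 * k * q.+1 ^ 3) (n ^ 2).
  pose P A := (8 * k * A ^ 3 < n ^ 2)%N.
  have P_le A : P A -> (A <= n)%N.
    rewrite /P => h; rewrite leqNgt; apply/negP => nA.
    have : (n ^ 2 <= A ^ 2)%N by rewrite leq_exp2r // ltnW.
    have : (A ^ 3 = A * A ^ 2)%N by ring.
    move: h; move: (A ^ 2)%N (A ^ 3)%N (n ^ 2)%N; nia.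
  have exP : exists A, P A by exists q.+1.
  case: (ex_maxnP exP P_le) => A PA maxA.
  have qA : (q.+1 <= A)%N by exact: maxA.
  have h1 : (n ^ 2 <= 8 * k * A.+1 ^ 3)%N.
    by rewrite leqNgt; apply/negP => /maxA; rewrite ltnn.
  have h2 : (n ^ 2 <= 4 ^ 3 * k * A ^ 3)%N.
    apply: (leq_trans h1); rewrite -[(4 ^ 3)%N]/(8 * 2 ^ 3)%N.
    have -> : (8 * 2 ^ 3 * k * A ^ 3 = 8 * k * (2 * A) ^ 3)%N by rewrite expnMn; ring.
    by rewrite leq_mul2l leq_exp2r // orbC; lia.
  have h3 : (t * k * A ^ 2 <= 3 * n ^ 2)%N.
    apply: (@stepanov_popular _ p) => //; [lia|exact: P_le|exact: nqp|].
    by move=> s; rewrite inE.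
  have h4 : ((n ^ 2) ^ 2 <= (4 ^ 3 * k * A ^ 3) ^ 2)%N by rewrite leq_exp2r.
  have h5 : ((t * k * A ^ 2) ^ 3 <= (3 * n ^ 2) ^ 3)%N by rewrite leq_exp2r.
  have e1 (a : nat) : ((a ^ 3 * k * A ^ 3) ^ 2 * (t ^ 3 * k) =
      (a ^ 2) ^ 3 * (t * k * A ^ 2) ^ 3)%N by ring.
  have e2 (a b : nat) : ((n ^ 2) ^ 2 * ((a ^ 2 * b) ^ 3 * n ^ 2) =
      (a ^ 2) ^ 3 * (b * n ^ 2) ^ 3)%N by ring.
  have : ((n ^ 2) ^ 2 * (t ^ 3 * k) <= (n ^ 2) ^ 2 * ((4 ^ 2 * 3) ^ 3 * n ^ 2))%N.
    apply: (@leq_trans ((4 ^ 3 * k * A ^ 3) ^ 2 * (t ^ 3 * k))).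
      by rewrite leq_mul2r h4 orbT.
    by rewrite e1 e2 leq_mul2l h5 orbT.
  by rewrite leq_pmul2l // !expn_gt0 n0.
(* Keep the largest number of classes allowed for A = q + 1. Then n^2 <= 16 k' (q + 1)^3, whereas
   [stepanov_popular] would give 225 k' (q + 1)^3 <= 3 n^2. *)
pose k' := ((n ^ 2).-1 %/ (8 * q.+1 ^ 3))%N.
have n2 : (0 < n ^ 2)%N by rewrite expn_gt0 n0.
have h1 : (k' * (8 * q.+1 ^ 3) <= (n ^ 2).-1)%N by exact: leq_trunc_div.
have h2 : ((n ^ 2).-1 < k'.+1 * (8 * q.+1 ^ 3))%N.
  by rewrite ltn_ceil // muln_gt0 expn_gt0.
have k'0 : (0 < k')%N by rewrite divn_gt0 ?muln_gt0 ?expn_gt0 //; lia.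
have k'k : (k' <= k)%N.
  have : (k' * (8 * q.+1 ^ 3) <= k * (8 * q.+1 ^ 3))%N.
    by apply: (leq_trans h1); apply: (leq_trans (leq_pred _)); rewrite mulnA (mulnC k).
  by rewrite leq_pmul2r // muln_gt0 expn_gt0.
have [S' S'S cS'] : exists2 S' : {set F * F}, S' \subset S & #|S'| = k'.
  pose s := take k' (enum S).
  have us : uniq s by rewrite take_uniq ?enum_uniq.
  exists [set x in s]; first by apply/subsetP => x; rewrite inE => /mem_take; rewrite mem_enum.
  by rewrite cardsE (card_uniqP us) size_takel // -cardE.
have h3 : (t * #|S'| * q.+1 ^ 2 <= 3 * n ^ 2)%N.
  apply: (@stepanov_popular _ p) => //.
  - rewrite leqNgt; apply/negP => nq.
    have : (n ^ 2 <= q.+1 ^ 2)%N by rewrite leq_exp2r // ltnW.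
    have : (q.+1 ^ 2 <= q.+1 ^ 3)%N by rewrite leq_pexp2l.
    by move: q3; move: (q.+1 ^ 2)%N (q.+1 ^ 3)%N (n ^ 2)%N; lia.
  - exact: nqp.
  - by rewrite cS'; move: h1 n2; move: (q.+1 ^ 3)%N (n ^ 2)%N; lia.
  - by move=> s /(subsetP S'S); rewrite inE.
rewrite cS' in h3.
exfalso; move: h3 h2 tq k'0.
have -> : (q.+1 ^ 3 = q.+1 * q.+1 ^ 2)%N by ring.
have : (0 < q.+1 ^ 2)%N by rewrite expn_gt0.
have : (0 < q.+1)%N by [].
move: (q.+1 ^ 2)%N => Q; move: (q.+1) (n ^ 2)%N => q1 N q10 Q0 h3 h2 tq k'0.
have h4 : (k'.+1 * (8 * (q1 * Q)) <= 2 * k' * (8 * (q1 * Q)))%N.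
  by rewrite leq_mul2r; apply/orP; right; lia.
have h5 : (225 * q1 * (k' * Q) <= t * (k' * Q))%N by rewrite leq_mul2r tq orbT.
have W0 : (0 < q1 * (k' * Q))%N by rewrite !muln_gt0 q10 k'0 Q0.
have e1 : (2 * k' * (8 * (q1 * Q)) = 16 * (q1 * (k' * Q)))%N by ring.
have e2 : (225 * q1 * (k' * Q) = 225 * (q1 * (k' * Q)))%N by ring.
rewrite e1 in h4; rewrite e2 in h5; rewrite -mulnA in h3.
lia.
Qed.

(** * Additive energy of the roots of unity *)

Lemma sqr_sum_mul_le (T : finType) (A : {pred T}) (f g : T -> nat) :
  ((\sum_(i in A) f i * g i) ^ 2 <=
   (\sum_(i in A) f i ^ 2) * (\sum_(i in A) g i ^ 2))%N.
Proof.
rewrite -(leq_pmul2l (_ : 0 < 2)%N) // -mulnn !big_distrlr /=.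
rewrite [leqRHS]mulSn mul1n [X in (_ <= _ + X)%N]exchange_big /=.
rewrite -big_split big_distrr /=; apply: leq_sum => i _.
rewrite -big_split big_distrr /=; apply: leq_sum => j _.
have -> : (f i * g i * (f j * g j) = (f i * g j) * (f j * g i))%N by ring.
rewrite -!expnMn; apply: leq_trans (nat_Cauchy _ _).1 _ => //=.
Qed.

(** The weights 1, 2t + 1 and 3(t + 1)^2 for [v] later turn first, second and third moments into
    counts of level sets. *)
Lemma sum_layer (T : finType) (A : {pred T}) (f : T -> nat) (v : nat -> nat) (n : nat) :
  (forall x, x \in A -> f x <= n)%N ->
  (\sum_(x in A) \sum_(t < f x) v t = \sum_(t < n) v t * #|[set x in A | t < f x]|)%N.
Proof.
move=> fn.
under eq_bigr => x xA do rewrite (big_ord_widen_cond n xpredT) ?fn //.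
rewrite (exchange_big_dep xpredT) //=; apply: eq_bigr => t _.
rewrite -sum1_card big_distrr /=; apply: eq_big => x; first by rewrite inE.
by rewrite muln1.
Qed.

Lemma card_le_fibers (T U : finType) (A : {set T}) (B : {set U}) (f : T -> U) (M : nat) :
  (forall x, x \in A -> f x \in B) ->
  (forall u, u \in B -> #|[set x in A | f x == u]| <= M)%N ->
  (#|A| <= #|B| * M)%N.
Proof.
move=> fAB fM; rewrite -sum1_card (partition_big f (mem B)) //= -sum_nat_const.
apply: leq_sum => u uB; apply: leq_trans (fM u uB).
by rewrite -sum1_card; apply: eq_leq; apply: eq_bigl => x; rewrite inE.
Qed.

Definition mu_set (F : finFieldType) (n : nat) : {set F} := [set x | x ^+ n == 1].

Definition rep (F : finFieldType) (n : nat) (x : F) : nat :=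
  #|[set a in mu_set F n | a - x \in mu_set F n]|.

(** The trivial difference 0, with |G| representations, is left out: dividing by the difference is
    what attaches a class to it. *)
Definition popular_diffs (F : finFieldType) (n t : nat) : {set F} :=
  [set x | (x != 0) && (t <= rep n x)%N].

Section RootsOfUnity.
Context (F : finFieldType) (n : nat).
Hypothesis n_gt0 : (0 < n)%N.
Local Notation G := (mu_set F n).
Local Notation D := (popular_diffs F n).

Lemma mu_setM (a b : F) : a \in G -> b \in G -> a * b \in G.
Proof. by rewrite !inE exprMn => /eqP -> /eqP ->; rewrite mulr1. Qed.

Lemma mu_setV (a : F) : (a^-1 \in G) = (a \in G).
Proof. by rewrite !inE exprVn invr_eq1. Qed.

Lemma mu_set_neq0 (a : F) : a \in G -> a != 0.
Proof.
rewrite inE; apply: contraTneq => ->.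
by rewrite expr0n eqn0Ngt n_gt0 eq_sym oner_eq0.
Qed.

Lemma mu_setMl (a b : F) : a \in G -> (a * b \in G) = (b \in G).
Proof.
move=> aG; apply/idP/idP => [abG|]; last exact: mu_setM.
by rewrite -(mulKf (mu_set_neq0 aG) b) mu_setM // mu_setV.
Qed.

Lemma repN (x : F) : rep n (- x) = rep n x.
Proof.
rewrite /rep -(card_imset _ (addIr x)); apply: eq_card => a.
rewrite !inE; apply/imsetP/idP => [[b]|/andP[aG axG]].
  by rewrite !inE opprK => /andP[bG bxG] ->; rewrite bxG addrK.
by exists (a - x); rewrite ?subrK // !inE opprK subrK aG axG.
Qed.

Lemma repM (u x : F) : u \in G -> rep n (u * x) = rep n x.
Proof.
move=> uG; have u0 := mu_set_neq0 uG.
rewrite /rep -[RHS](card_imset _ (mulfI u0)); apply: eq_card => a.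
apply/idP/imsetP => [|[b]].
  rewrite inE => /andP[aG auG]; exists (u^-1 * a); last by rewrite mulVKf.
  rewrite inE -(mu_setMl _ uG) mulVKf // aG /=.
  by rewrite -(mu_setMl _ uG) mulrBr mulVKf.
by rewrite inE => /andP[bG bxG] ->; rewrite inE -mulrBr !mu_setMl // bG.
Qed.

Lemma rep_le (x : F) : (rep n x <= #|G|)%N.
Proof. by apply: subset_leq_card; apply/subsetP => a; rewrite inE => /andP[]. Qed.

Lemma rep0 : rep n (0 : F) = #|G|.
Proof. by apply: eq_card => a; rewrite inE subr0 andbb. Qed.

Lemma repE (x : F) : rep n x = (\sum_(a in G) ((a - x)%R \in G))%N.
Proof.
rewrite /rep -sum1_card big_mkcond [RHS]big_mkcond; apply: eq_bigr => a _.
by rewrite !inE; case: (_ == 1); case: (_ == 1).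
Qed.

(** This presents [rep n (b - c)] as a Gram matrix, which is where its positive semidefiniteness
    comes from. *)
Lemma sum_mu_shift (b c : F) :
  (\sum_(s : F) (((b - s)%R \in G) * ((c - s)%R \in G)) = rep n (b - c)%R)%N.
Proof.
rewrite repE [RHS]big_mkcond (reindex (fun a => b - a)) /=; last first.
  by exists (fun a => b - a) => a _; rewrite subKr.
apply: eq_bigr => a _; rewrite subKr !opprB.
have -> : c + (a - b) = a + (c - b) by ring.
by case: (a \in G); rewrite ?mul1n.
Qed.

Lemma sum_rep : (\sum_(x : F) rep n x = #|G| ^ 2)%N.
Proof.
under eq_bigr => x _ do rewrite repE.
rewrite exchange_big /= -mulnn -sum_nat_const; apply: eq_bigr => a _.
rewrite (reindex (fun x => a - x)) /=; last by exists (fun x => a - x) => x _; rewrite subKr.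
by under eq_bigr => x _ do rewrite subKr; rewrite -big_mkcond sum1_card.
Qed.

(** Dividing x = a - b by x gives the point a/x with 1 - a/x = -b/x; the n-th powers of both are the
    same for all representations of x. *)
Lemma rep_le_cls_mult (x : F) : x != 0 ->
  (rep n x <= cls_mult n (x^-1 ^+ n, (- x^-1) ^+ n))%N.
Proof.
move=> x0; have xV0 : x^-1 != 0 by rewrite invr_eq0.
rewrite /rep -(card_imset _ (mulIf xV0)); apply: subset_leq_card.
apply/subsetP => _ /imsetP[a /setIdP[aG axG] ->].
rewrite !inE mulf_neq0 ?(mu_set_neq0 aG) //=; apply/andP; split.
  apply: contraTneq axG => /(congr1 ( *%R^~ x)); rewrite mulfVK // mul1r => ->.
  by rewrite subrr; apply/negP => /mu_set_neq0; rewrite eqxx.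
rewrite /cls; have -> : 1 - a / x = (a - x) * - x^-1 by field.
move: aG axG; rewrite !inE !exprMn => /eqP -> /eqP ->.
by rewrite !mul1r.
Qed.

(** [P] is a union of cosets of G and x^n is constant on each, so the set of n-th powers stands for
    the quotient of [P] by G. *)
Lemma mul_card_expr_image_le (P : {set F}) : 0 \notin P ->
  (forall u x, u \in G -> x \in P -> u * x \in P) ->
  (#|G| * #|[set x ^+ n | x in P]| <= #|P|)%N.
Proof.
move=> P0 PG; rewrite mulnC -sum_nat_const.
rewrite -[leqRHS]sum1_card.
rewrite [leqRHS](partition_big (fun x => x ^+ n) (mem [set x ^+ n | x in P])) /=;
  last by move=> x xP; exact: (imset_f (fun x => x ^+ n)) xP.
apply: leq_sum => _ /imsetP[x xP ->].
have x0 : x != 0 by apply: contraNneq P0 => <-.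
rewrite -(card_imset _ (mulIf x0)) -sum1_card.
rewrite [leqLHS]big_mkcond [leqRHS]big_mkcond; apply: leq_sum => y _.
case: imsetP => [[u uG ->]|//]; rewrite PG //=.
by move: uG; rewrite inE exprMn => /eqP ->; rewrite mul1r eqxx.
Qed.

End RootsOfUnity.

(** * Energies and the spectral inequality *)

Definition energy (F : finFieldType) (n : nat) : nat := (\sum_(x : F) rep n x ^ 2)%N.

Definition third_energy (F : finFieldType) (n : nat) : nat :=
  (\sum_(x : F) rep n x ^ 3)%N.

Section PopularSet.
Context (F : finFieldType) (n : nat).
Hypothesis n_gt0 : (0 < n)%N.
Local Notation G := (mu_set F n).
Local Notation D := (popular_diffs F n).
Hypothesis cardG : #|G| = n.

Lemma popular_diffs_stable (t : nat) (u x : F) : u \in G -> x \in D t -> u * x \in D t.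
Proof.
by move=> uG; rewrite !inE repM // mulf_eq0 (negbTE (mu_set_neq0 n_gt0 uG)).
Qed.

Lemma popular_diffsN (t : nat) (x : F) : x \in D t -> - x \in D t.
Proof. by rewrite !inE repN oppr_eq0. Qed.

Lemma popular_diffs_neq0 (t : nat) : 0 \notin D t.
Proof. by rewrite inE eqxx. Qed.

(** Each class accounts for at most n differences x, because its first coordinate is the n-th power
    of 1/x. *)
Lemma card_popular_diffs (p t : nat) :
  p \in [pchar F] -> (n ^ 3 <= p ^ 2)%N -> (threshold p n <= t)%N ->
  (t ^ 3 * #|D t| <= 48 ^ 3 * n ^ 3)%N.
Proof.
move=> charp np pt.
have h : (#|D t| <= #|[set s : F * F | (t <= cls_mult n s)%N]| * n)%N.
  apply: (card_le_fibers (f := fun x : F => (x^-1 ^+ n, (- x^-1) ^+ n))).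
    move=> x; rewrite !inE => /andP[x0 tx].
    exact: leq_trans tx (rep_le_cls_mult n_gt0 x0).
  move=> s _; apply: leq_trans (card_expr_eq_le s.1 n_gt0).
  rewrite -(card_imset _ (@invr_inj F)); apply: subset_leq_card.
  apply/subsetP => _ /imsetP[x /setIdP[_ /eqP <-] ->].
  by rewrite inE.
have := card_popular_classes charp n_gt0 np pt; move: h.
move: #|[set s : F * F | (t <= cls_mult n s)%N]| => k h hk.
apply: (@leq_trans (t ^ 3 * (k * n))); first by rewrite leq_mul2l h orbT.
have -> : (n ^ 3 = n ^ 2 * n)%N by ring.
by rewrite (mulnA (t ^ 3)%N) (mulnA (48 ^ 3)%N) leq_mul2r hk orbT.
Qed.

(** Expanding the square gives pairs (a, b) in G for which x and y are summed independently, so that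
    each pair contributes [rep n (a - b) ^ 2]; a given difference comes from [rep] pairs, whence the
    cube. *)
Lemma sum_sqr_triple :
  (\sum_(x : F) \sum_(y : F)
     (\sum_(a in G) ((a - x)%R \in G) * ((a - y)%R \in G)) ^ 2 = third_energy F n)%N.
Proof.
under eq_bigr => x _ do under eq_bigr => y _ do rewrite -mulnn big_distrlr /=.
under eq_bigr => x _ do rewrite exchange_big /=.
rewrite exchange_big /=.
under eq_bigr => a _ do under eq_bigr => x _ do rewrite exchange_big /=.
under eq_bigr => a _ do rewrite exchange_big /=.
transitivity (\sum_(a in G) \sum_(b in G) rep n (a - b)%R ^ 2)%N.
  apply: eq_bigr => a _; apply: eq_bigr => b _.
  rewrite -(sum_mu_shift n a b) -mulnn big_distrlr /=.
  by apply: eq_bigr => x _; apply: eq_bigr => y _; rewrite mulnACA.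
rewrite /third_energy; under [RHS]eq_bigr => x _ do rewrite expnSr {2}repE big_distrr /=.
rewrite [RHS]exchange_big /=; apply: eq_bigr => a _.
rewrite [RHS](reindex (fun b => a - b)) /=; last by exists (fun b => a - b) => b _; rewrite subKr.
rewrite big_mkcond; apply: eq_bigr => b _; rewrite subKr.
by case: (b \in G); rewrite ?muln1 ?muln0.
Qed.

Context (P : {set F}).
Hypothesis PN : forall x, x \in P -> - x \in P.
Hypothesis PG : forall u x, u \in G -> x \in P -> u * x \in P.

Definition unit_shift : {set F} := [set b in G | 1 - b \in P].
Local Notation B := unit_shift.

Lemma stableMl (u x : F) : u \in G -> (u * x \in P) = (x \in P).
Proof.
move=> uG; apply/idP/idP => [uxP|]; last exact: PG.
by rewrite -(mulKf (mu_set_neq0 n_gt0 uG) x) PG // mu_setV.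
Qed.

(** Multiplication by [a] carries the pairs attached to the base point 1 to those attached to [a],
    so all base points in G contribute equally. *)
Lemma sum_scale (g : F -> F -> F -> nat) (a : F) : a \in G ->
  (forall b c, g a (a * b) (a * c) = g 1 b c) ->
  (\sum_(b in G | (a - b)%R \in P) \sum_(c in G | (a - c)%R \in P) g a b c =
   \sum_(b in B) \sum_(c in B) g 1%R b c)%N.
Proof.
move=> aG gE; have a0 := mu_set_neq0 n_gt0 aG.
have bij : bijective (fun b => a * b).
  by exists (fun b => a^-1 * b) => b; rewrite (mulKf, mulVKf).
have predE b : (a * b \in G) && (a - a * b \in P) = (b \in B).
  by rewrite mu_setMl // -{1}[a]mulr1 -mulrBr stableMl // [RHS]inE.
rewrite (reindex _ (onW_bij _ bij)) /=; apply: eq_big => // b _.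
by rewrite (reindex _ (onW_bij _ bij)) /=; apply: eq_big.
Qed.

Lemma card_unit_shift (a : F) : a \in G ->
  (\sum_(b in G) ((a - b)%R \in P) = #|B|)%N.
Proof.
move=> aG; have a0 := mu_set_neq0 n_gt0 aG.
rewrite -sum1_card -big_mkcondr /= (reindex (fun b => a * b)) /=; last first.
  by apply: onW_bij; exists (fun b => a^-1 * b) => b; rewrite (mulKf, mulVKf).
apply: eq_bigl => b.
by rewrite mu_setMl // -{1}[a]mulr1 -mulrBr stableMl // [RHS]inE.
Qed.

Lemma sum_rep_popular : (n * #|B| = \sum_(x in P) rep n x)%N.
Proof.
under [RHS]eq_bigr => x _ do rewrite repE.
rewrite exchange_big /= -[X in (X * _)%N]cardG -sum_nat_const; apply: eq_bigr => a aG.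
rewrite -(card_unit_shift aG) big_mkcond [RHS]big_mkcond /=.
rewrite [RHS](reindex (fun b => a - b)) /=; last by exists (fun b => a - b) => b _; rewrite subKr.
by apply: eq_bigr => b _; rewrite subKr; case: (b \in G); case: (_ \in P).
Qed.

Definition unit_shift_energy : nat := (\sum_(b in B) \sum_(c in B) rep n (b - c)%R)%N.

(* The trivial character of G is an eigenvector of the G-circulant matrices
   [a - b \in P] and rep (a - b); the second one is positive semidefinite, so
   that keeping this eigenvector alone bounds the trace from below. *)
Lemma unit_shift_energy_ge :
  (#|B| ^ 2 * energy F n <= n ^ 2 * unit_shift_energy)%N.
Proof.
(* [v] is the product of the matrices [a - b in P] and [b - s in G]. By homogeneity its rows all
   have squared norm [unit_shift_energy], and its column sums are |B| [rep n s]; the Cauchy-Schwarz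
   inequality in [a] then does the work of the spectral decomposition. *)
pose v (a s : F) := (\sum_(b in G | (a - b)%R \in P) ((b - s)%R \in G))%N.
have v2 a : a \in G -> (\sum_s v a s ^ 2 = unit_shift_energy)%N.
  move=> aG; under eq_bigr => s _ do rewrite -mulnn big_distrlr /=.
  rewrite exchange_big /=; under eq_bigr => b _ do rewrite exchange_big /=.
  under eq_bigr => b _ do under eq_bigr => c _ do rewrite sum_mu_shift.
  apply: (sum_scale (g := fun _ b c => rep n (b - c))) => // b c.
  by rewrite -mulrBr repM.
have v1 s : (\sum_(a in G) v a s = #|B| * rep n s)%N.
  rewrite /v; under eq_bigr => a _ do rewrite big_mkcondr /=.
  rewrite exchange_big repE big_distrr /=; apply: eq_bigr => b bG.
  have -> : #|B| = (\sum_(a in G) ((a - b)%R \in P))%N.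
    rewrite -(card_unit_shift bG); apply: eq_bigr => a _; congr (nat_of_bool _).
    by apply/idP/idP => /PN; rewrite opprB.
  by rewrite big_distrl /=; apply: eq_bigr => a _; case: (_ \in P); rewrite ?mul1n.
rewrite /energy big_distrr /=.
apply: (@leq_trans (\sum_s n * \sum_(a in G) v a s ^ 2)%N).
  apply: leq_sum => s _; rewrite -expnMn -v1.
  have -> : (\sum_(a in G) v a s = \sum_(a in G) v a s * 1)%N.
    by apply: eq_bigr => a _; rewrite muln1.
  apply: (leq_trans (sqr_sum_mul_le (mem G) (v^~ s) (fun=> 1%N))).
  by rewrite sum_nat_const cardG muln1 mulnC.
rewrite -big_distrr exchange_big /= -mulnn -mulnA leq_mul2l; apply/orP; right.
by rewrite (eq_bigr _ v2) sum_nat_const cardG.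
Qed.

End PopularSet.

Lemma sum_odd (m : nat) : (\sum_(t < m) (2 * t + 1) = m ^ 2)%N.
Proof. by elim: m => [|m IH]; rewrite ?big_ord0 // big_ord_recr /= IH; ring. Qed.

(** * Pairs whose ratio lies in a small or a large class *)

Section RatioClasses.
Context (F : finFieldType) (n : nat).
Hypothesis n_gt0 : (0 < n)%N.
Local Notation G := (mu_set F n).
Local Notation D := (popular_diffs F n).
Hypothesis cardG : #|G| = n.

Lemma sum_popular (v : nat -> nat) :
  (\sum_(x : F | x != 0%R) \sum_(t < rep n x) v t = \sum_(t < n) v t * #|D t.+1|)%N.
Proof.
rewrite (@sum_layer _ [pred x : F | x != 0] (rep n) v n); last first.
  by move=> x _; rewrite -[leqRHS]cardG rep_le.
by apply: eq_bigr => t _; congr (_ * _)%N; apply: eq_card => x; rewrite !inE.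
Qed.

Definition ratio_mult (x y : F) : nat := cls_mult n (cls n (x / y)).

Lemma cls_ratio (x y : F) : y != 0 ->
  cls n (x / y) = (x ^+ n / y ^+ n, (y - x) ^+ n / y ^+ n).
Proof.
move=> y0; rewrite /cls; have -> : 1 - x / y = (y - x) / y by field.
by rewrite !exprMn !exprVn.
Qed.

Lemma ratio_multM (u x y : F) : u \in G -> ratio_mult (u * x) (u * y) = ratio_mult x y.
Proof. by move=> uG; rewrite /ratio_mult -mulf_div divff ?mul1r // (mu_set_neq0 n_gt0 uG). Qed.

Context (P : {set F}).
Hypothesis P0 : 0 \notin P.
Hypothesis PG : forall u x, u \in G -> x \in P -> u * x \in P.
Local Notation B := (unit_shift n P).

Lemma set_neq0 (x : F) : x \in P -> x != 0.
Proof. by apply: contraTneq => ->. Qed.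

(** The n-th powers of x, y and y - x fix the class of x / y, which leaves fewer than T ratios, and
    then at most n values of y. The three quotients by G gain n^3, of which one factor n is lost to
    y. *)
Lemma card_low_ratio_le (T t : nat) :
  (n ^ 2 * #|[set xy in setX P P |
       [&& xy.1 != xy.2, (ratio_mult xy.1 xy.2 < T)%N & (xy.2 - xy.1)%R \in D t]]|
   <= T * #|P| ^ 2 * #|D t|)%N.
Proof.
set U := [set xy in _ | _].
pose im (Q : {set F}) := [set x ^+ n | x in Q].
have imP (Q : {set F}) : 0 \notin Q -> (forall u x, u \in G -> x \in Q -> u * x \in Q) ->
    (n * #|im Q| <= #|Q|)%N.
  by move=> Q0 QG; rewrite -{1}cardG; exact: mul_card_expr_image_le.
have hP := imP P P0 PG.
have hD := imP (D t) (popular_diffs_neq0 F n t) (fun u x => @popular_diffs_stable F n n_gt0 t u x).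
have hU : (#|U| <= #|setX (setX (im P) (im P)) (im (D t))| * (T * n))%N.
  apply: (card_le_fibers (f := fun xy : F * F =>
    ((xy.1 ^+ n, xy.2 ^+ n), (xy.2 - xy.1) ^+ n))).
    move=> [x y]; rewrite inE => /andP[/setXP[/= xP yP] /and3P[/= _ _ xyD]].
    rewrite !in_setX /=; apply/andP; split; first (apply/andP; split);
      exact: (imset_f (fun x => x ^+ n)).
  move=> [[u v] z] _; set V := [set xy in U | _].
  have [->|[[x0 y0]]] := set_0Vmem V; first by rewrite cards0.
  rewrite inE => /andP[]; rewrite inE => /andP[/setXP[/= x0P y0P] /and3P[/= _ lo _]].
  move=> /eqP[x0u y0v z0].
  have {}lo : (cls_mult n (u / v, z / v) < T)%N.
    by rewrite -x0u -y0v -z0 -cls_ratio ?set_neq0.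
  apply: (@leq_trans (#|setX (cls_preim n [set (u / v, z / v)]) [set y | y ^+ n == v]|)); last first.
    by rewrite cardsX leq_mul ?card_expr_eq_le // ltnW.
  rewrite -(card_in_imset (f := fun xy : F * F => (xy.1 / xy.2, xy.2)) (D := mem V)); last first.
    move=> [x y] [x' y']; rewrite inE => /andP[]; rewrite inE => /andP[/setXP[/= _ yP] _] _ _.
    by case=> + yy'; rewrite -yy' => /(divIf (set_neq0 yP)) ->.
  apply: subset_leq_card; apply/subsetP => _ /imsetP[[x y] + ->] /=.
  rewrite inE => /andP[]; rewrite inE => /andP[/setXP[/= xP yP] /and3P[/= xy _ _]].
  move=> /eqP[xu yv zE]; have y_neq0 := set_neq0 yP; have x_neq0 := set_neq0 xP.
  rewrite !inE /= cls_ratio // xu yv zE !eqxx /= !andbT.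
  rewrite mulf_neq0 ?invr_eq0 //=; apply: contraNneq xy => /(congr1 ( *%R^~ y)).
  by rewrite mulfVK // mul1r => ->.
rewrite !cardsX in hU.
have : (n ^ 3 * #|U| <= n * (T * #|P| ^ 2 * #|D t|))%N.
  apply: (@leq_trans (n ^ 3 * (#|im P| * #|im P| * #|im (D t)| * (T * n)))).
    by rewrite leq_mul2l hU orbT.
  have -> : (n ^ 3 * (#|im P| * #|im P| * #|im (D t)| * (T * n)) =
     n * (T * (n * #|im P|) ^ 2 * (n * #|im (D t)|)))%N by ring.
  by rewrite leq_mul2l; apply/orP; right; rewrite !leq_mul // leq_exp2r.
by rewrite expnS -mulnA leq_pmul2l.
Qed.

Definition low_sum (T : nat) : nat :=
  (\sum_(b in B) \sum_(c in B)
    ((b != c) && (ratio_mult (1 - b)%R (1 - c)%R < T)) * rep n (b - c)%R)%N.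

(** By homogeneity, n times the sum runs over (x, y) = (a - b, a - c) in P^2, weighted by the number
    [C] of admissible [a]. In the Cauchy-Schwarz inequality the weights give the third energy, and
    [h] is summed by levels of y - x through [card_low_ratio_le], which rebuilds the energy. *)
Lemma low_sum_le (T : nat) :
  ((n ^ 2 * low_sum T) ^ 2 <= third_energy F n * (T * #|P| ^ 2 * energy F n))%N.
Proof.
pose C (xy : F * F) := (\sum_(a in G) ((a - xy.1)%R \in G) * ((a - xy.2)%R \in G))%N.
pose h (xy : F * F) :=
  (((xy.1 != xy.2) && (ratio_mult xy.1 xy.2 < T)) * rep n (xy.2 - xy.1)%R)%N.
have lowE : (n * low_sum T = \sum_(xy in setX P P) C xy * h xy)%N.
  rewrite -{1}cardG -sum_nat_const.
  pose g (a b c : F) := (((b != c) && (ratio_mult (a - b)%R (a - c)%R < T)) * rep n (b - c)%R)%N.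
  transitivity (\sum_(a in G) \sum_(b in G | (a - b)%R \in P)
     \sum_(c in G | (a - c)%R \in P) g a b c)%N.
    apply: eq_bigr => a aG; rewrite (sum_scale n_gt0 PG (g := g)) // => b c.
    rewrite /g -mulrBr repM // (inj_eq (mulfI (mu_set_neq0 n_gt0 aG))).
    by rewrite -{1 3}[a]mulr1 -!mulrBr ratio_multM.
  under eq_bigr => a aG.
    rewrite (reindex (fun x => a - x)) /=; last by exists (fun x => a - x) => x _; rewrite subKr.
    under eq_bigr => x _.
      rewrite (reindex (fun y => a - y)) /=; last by exists (fun y => a - y) => y _; rewrite subKr.
      over.
    over.
  have -> : (\sum_(xy in setX P P) C xy * h xy =
      \sum_(x in P) \sum_(y in P) C (x, y) * h (x, y))%N.
    by rewrite pair_big /=; apply: eq_big => [[x y]|[x y] _] //; rewrite in_setX.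
  under [RHS]eq_bigr => x _ do under eq_bigr => y _ do rewrite /C big_distrl /=.
  under [RHS]eq_bigr => x _ do rewrite exchange_big /=.
  rewrite [RHS]exchange_big /=; apply: eq_bigr => a aG.
  rewrite big_mkcond [RHS]big_mkcond; apply: eq_bigr => x _; rewrite subKr.
  case: (x \in P); rewrite ?andbF // andbT.
  case: (a - x \in G); last by rewrite big1 // => y _; rewrite mul0n.
  rewrite big_mkcond [RHS]big_mkcond; apply: eq_bigr => y _; rewrite subKr.
  case: (y \in P); rewrite ?andbF // andbT.
  case: (a - y \in G); last by rewrite muln0.
  rewrite !mul1n /g /h /= !subKr; congr (_ * _)%N; last by congr rep; ring.
  by rewrite (inj_eq (subrI a)).
have C2 : (\sum_(xy in setX P P) C xy ^ 2 <= third_energy F n)%N.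
  rewrite -sum_sqr_triple // (pair_bigA _ (fun x y => (\sum_(a in G) ((a - x)%R \in G) * ((a - y)%R \in G)) ^ 2)%N) /=.
  by rewrite big_mkcond; apply: leq_sum => xy _; case: ifP.
have h2 : (n ^ 2 * \sum_(xy in setX P P) h xy ^ 2 <= T * #|P| ^ 2 * energy F n)%N.
  pose U := [set xy in setX P P | (xy.1 != xy.2) && (ratio_mult xy.1 xy.2 < T)%N].
  have -> : (\sum_(xy in setX P P) h xy ^ 2 =
      \sum_(xy in U) \sum_(t < rep n (xy.2 - xy.1)%R) (2 * t + 1))%N.
    rewrite big_mkcond [RHS]big_mkcond; apply: eq_bigr => xy _.
    rewrite sum_odd [xy \in U]inE /h; case: (xy \in setX P P); rewrite //=.
    by case: (_ && _); rewrite ?mul1n ?mul0n.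
  rewrite (@sum_layer _ U (fun xy => rep n (xy.2 - xy.1)) (fun t => 2 * t + 1)%N n); last first.
    by move=> x _; rewrite -[leqRHS]cardG rep_le.
  rewrite /energy (bigD1 0) //= mulnDr (leq_trans _ (leq_addl _ _)) //.
  have -> : (\sum_(x : F | x != 0%R) rep n x ^ 2 =
      \sum_(t < n) (2 * t + 1) * #|D t.+1|)%N.
    by rewrite -(sum_popular (fun t => 2 * t + 1)%N); apply: eq_bigr => x _; rewrite sum_odd.
  rewrite !big_distrr /=; apply: leq_sum => t _.
  rewrite mulnCA [leqRHS]mulnCA leq_mul2l; apply/orP; right.
  apply: leq_trans (card_low_ratio_le T t.+1).
  rewrite leq_mul2l; apply/orP; right; apply: subset_leq_card.
  apply/subsetP => -[x y]; rewrite !inE /= => /andP[/andP[-> /andP[xy ->]] ->].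
  by rewrite subr_eq0 [y == x]eq_sym xy.
have e : ((n ^ 2 * low_sum T) ^ 2 = n ^ 2 * (n * low_sum T) ^ 2)%N by ring.
rewrite e lowE.
apply: (@leq_trans (n ^ 2 * (third_energy F n * \sum_(xy in setX P P) h xy ^ 2))).
  rewrite leq_mul2l; apply/orP; right; apply: leq_trans (sqr_sum_mul_le _ _ _) _.
  by rewrite leq_mul2r C2 orbT.
by rewrite mulnCA leq_mul2l h2 orbT.
Qed.

Definition high_pairs (T : nat) : {set F * F} :=
  [set bc in setX B B | (bc.1 != bc.2) && (T <= ratio_mult (1 - bc.1)%R (1 - bc.2)%R)%N].

Lemma unit_shift_energy_split (T : nat) :
  (unit_shift_energy n P = n * #|B| + low_sum T +
     \sum_(bc in high_pairs T) rep n (bc.1 - bc.2)%R)%N.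
Proof.
have -> : (\sum_(bc in high_pairs T) rep n (bc.1 - bc.2)%R =
   \sum_(b in B) \sum_(c in B)
    ((b != c) && (T <= ratio_mult (1 - b)%R (1 - c)%R)) * rep n (b - c)%R)%N.
  rewrite pair_big /= big_mkcond [RHS]big_mkcond /=; apply: eq_bigr => -[b c] _.
  rewrite inE in_setX /=; case: ((b \in B) && (c \in B)) => //=.
  by case: ((b != c) && _); rewrite ?mul1n.
have -> : (n * #|B| = \sum_(b in B) \sum_(c in B) (b == c) * rep n (b - c)%R)%N.
  rewrite mulnC -sum_nat_const; apply: eq_bigr => b bB.
  rewrite (bigD1 b) //= eqxx subrr rep0 cardG mul1n big1 ?addn0 // => c /andP[_ bc].
  by rewrite eq_sym (negbTE bc).
rewrite -!big_split /=; apply: eq_bigr => b _.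
rewrite -!big_split /=; apply: eq_bigr => c _.
rewrite ltnNge -!mulnDl; case: eqP => _ /=; first by rewrite !addn0 mul1n.
by case: (T <= _)%N; rewrite ?addn0 ?add0n mul1n.
Qed.

(* With lambda = (1 - b) / (1 - c), the points lambda and lambda c / b lie in
   the same class and determine (b, c). *)
Lemma card_high_pairs_le (T t : nat) : exists S : {set F * F},
  [/\ (n ^ 3 * #|S| <= #|P| ^ 2 * #|D t|)%N,
      forall s, s \in S -> (T <= cls_mult n s)%N
    & (#|[set bc in high_pairs T | (bc.1 - bc.2)%R \in D t]|
        <= \sum_(s in S) cls_mult n s ^ 2)%N].
Proof.
pose im (Q : {set F}) := [set x ^+ n | x in Q].
have imP (Q : {set F}) : 0 \notin Q -> (forall u x, u \in G -> x \in Q -> u * x \in Q) ->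
    (n * #|im Q| <= #|Q|)%N.
  by move=> Q0 QG; rewrite -{1}cardG; exact: mul_card_expr_image_le.
have hP := imP P P0 PG.
have hD := imP (D t) (popular_diffs_neq0 F n t) (fun u x => @popular_diffs_stable F n n_gt0 t u x).
(* From the n-th powers of x = 1 - b, y = 1 - c and b - c = y - x, [psi] recovers the class of x /
   y; the number of classes is thus at most a product of three quotients by G. *)
pose psi (w : F * F * F) := (w.1.1 / w.1.2, w.2 / w.1.2).
pose S := [set s in psi @: setX (setX (im P) (im P)) (im (D t)) | (T <= cls_mult n s)%N].
exists S; split; last 1 first.
- pose lam (bc : F * F) := (1 - bc.1) / (1 - bc.2).
  set V := [set bc in _ | _].
  have VP bc : bc \in V -> [/\ bc.1 \in G, bc.2 \in G, 1 - bc.1 \in P, 1 - bc.2 \in P &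
      [/\ bc.1 != bc.2, (T <= cls_mult n (cls n (lam bc)))%N & bc.1 - bc.2 \in D t]].
    case: bc => b c; rewrite inE => /andP[]; rewrite inE => /andP[/setXP[/=]].
    by move=> /setIdP[? ?] /setIdP[? ?] /andP[].
  have clsV bc : bc \in V -> cls n (lam bc) \in S.
    move=> /VP[bG cG bP cP [bc' hi bcD]]; rewrite inE hi andbT.
    rewrite /lam cls_ratio ?set_neq0 //; apply/imsetP.
    exists (((1 - bc.1) ^+ n, (1 - bc.2) ^+ n), (bc.1 - bc.2) ^+ n).
      by rewrite !in_setX /=; apply/andP; split; first (apply/andP; split);
        exact: (imset_f (fun x => x ^+ n)).
    by rewrite /psi /=; congr (_, _ / _); congr (_ ^+ _); ring.
  rewrite -sum1_card (partition_big (fun bc => cls n (lam bc)) (mem S)) //=.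
  apply: leq_sum => s sS; rewrite -mulnn /cls_mult -cardsX.
  pose f (bc : F * F) := (lam bc, lam bc * bc.2 / bc.1).
  rewrite sum1_card.
  rewrite -(card_in_imset (f := f) (D := [pred bc | (bc \in V) && (cls n (lam bc) == s)])); last first.
    move=> [b c] [b' c'] /andP[/VP[/= bG cG bP cP [bc _ _]] _].
    move=> /andP[/VP[/= bG' cG' bP' cP' [bc' _ _]] _] [].
    rewrite /lam /= => e1; rewrite -e1 => e2.
    have [b0 c0] := (mu_set_neq0 n_gt0 bG, mu_set_neq0 n_gt0 cG).
    have [b'0 c'0] := (mu_set_neq0 n_gt0 bG', mu_set_neq0 n_gt0 cG').
    have [[xb xc] xc'] := (set_neq0 bP, set_neq0 cP, set_neq0 cP').
    have l0 : (1 - b) / (1 - c) != 0 by rewrite mulf_neq0 ?invr_eq0.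
    have e3 : c / b = c' / b' by apply: (mulfI l0); rewrite !mulrA.
    have e4 : (1 - b) * (1 - c') = (1 - b') * (1 - c).
      by move/eqP: e1; rewrite eqr_div // => /eqP ->.
    have e5 : c * b' = c' * b by move/eqP: e3; rewrite eqr_div // => /eqP.
    (* Eliminating c' from the relations [e4] and [e5] leaves this product. As b and c differ, b' =
       b, and then c' = c. *)
    have : (c - b) * (b' - b) = 0.
      have -> : (c - b) * (b' - b) = - b * ((1 - b) * (1 - c') - (1 - b') * (1 - c))
          + (b - 1) * (c' * b - c * b') by ring.
      by rewrite e4 e5 !subrr !mulr0 addr0.
    move=> /eqP; rewrite mulf_eq0 !subr_eq0 eq_sym (negbTE bc) /= => /eqP bb'.
    by move: e5; rewrite bb' => /(mulIf b0) ->.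
  apply: subset_leq_card; apply/subsetP => _ /imsetP[[b c] /andP[/VP[/= bG cG bP cP [bc _ _]] /eqP <-] ->].
  have [b0 c0] := (mu_set_neq0 n_gt0 bG, mu_set_neq0 n_gt0 cG).
  have [xb xc] := (set_neq0 bP, set_neq0 cP).
  have l0 : lam (b, c) != 0 by rewrite mulf_neq0 ?invr_eq0.
  have l1 : lam (b, c) != 1.
    apply: contraNneq bc => /(congr1 ( *%R^~ (1 - c))); rewrite mulfVK // mul1r.
    by move=> /= /addrI /oppr_inj ->.
  have [bn cn] : b ^+ n = 1 /\ c ^+ n = 1 by move: bG cG; rewrite !inE => /eqP -> /eqP ->.
  (* Since b and c are n-th roots of unity, this identity puts the second point in the class of the
     first. *)
  have e : 1 - lam (b, c) * c / b = (1 - lam (b, c)) / b.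
    by rewrite /lam /=; field; rewrite b0 xc.
  rewrite in_setX !inE /= l0 l1 eqxx /=; apply/and3P; split.
  + by rewrite !mulf_neq0 ?invr_eq0.
  + rewrite -subr_eq0 -opprB oppr_eq0 e mulf_neq0 ?invr_eq0 //.
    by rewrite subr_eq0 eq_sym.
  + by rewrite /cls e !exprMn !exprVn bn cn invr1 !mulr1.
- have hS : (#|S| <= #|im P| * #|im P| * #|im (D t)|)%N.
    rewrite -!cardsX; apply: leq_trans (leq_imset_card psi _).
    by apply: subset_leq_card; apply/subsetP => s; rewrite inE => /andP[].
  apply: (@leq_trans (n ^ 3 * (#|im P| * #|im P| * #|im (D t)|))).
    by rewrite leq_mul2l hS orbT.
  have -> : (n ^ 3 * (#|im P| * #|im P| * #|im (D t)|) =
     (n * #|im P|) ^ 2 * (n * #|im (D t)|))%N by ring.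
  by rewrite leq_mul // leq_exp2r.
- by move=> s; rewrite inE => /andP[].
Qed.

End RatioClasses.

(** * Balancing the estimates at one level *)

Lemma le_of_exp_le (R : realFieldType) (k : nat) (x y : R) :
  0 <= y -> x ^+ k.+1 <= y ^+ k.+1 -> x <= y.
Proof.
move=> y0 xy; have [//|yx] := leP x y.
by move: xy; rewrite leNgt ltrXn2r.
Qed.

(** Here [d] is the level t, [P] and [b] are the cardinals of the popular set and of the set B, and
    [m] is the mass. Up to powers of c and H, either E is at most n^2 T0, or one of three parts
    dominates the spectral inequality: the diagonal, giving m^3 <= n^7; the low ratios, giving m^3
    <= n^7 T0; the high ratios, giving m^9 <= n^22. [Y] is a common majorant. *)
Lemma popular_mass_le (R : realFieldType) (c n T0 b E E3 lo H m d P Y : R) :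
  12 <= c -> 0 < n -> 1 <= T0 -> 1 <= H -> 0 < P -> 0 < d ->
  m = d ^+ 2 * P -> m <= E -> d * P <= n * b -> d ^+ 3 * P <= c * n ^+ 3 ->
  E3 <= 9 * c * n ^+ 3 * H -> (n ^+ 2 * lo) ^+ 2 <= E3 * (T0 * P ^+ 2 * E) ->
  (forall w, 0 < w -> b ^+ 2 * E <=
     n ^+ 2 * (n * b + lo + T0 * b ^+ 2
               + H * (c * w ^+ 2 * P ^+ 2 + 3 * c * n ^+ 2 * H / w))) ->
  0 < Y -> n ^+ 22 <= Y ^+ 9 -> n ^+ 7 * T0 <= Y ^+ 3 -> n ^+ 2 * T0 <= Y ->
  m <= c * H * Y.
Proof.
move=> c9 n0 T1 H1 P0 d0 mE mleE dP d3P E3le lole hi Y0 Y9 Y3 Y1.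
have c0 : 0 < c by lra.
have H0 : 0 < H by lra.
have T00 : 0 < T0 by lra.
have m0 : 0 < m by rewrite mE mulr_gt0 // exprn_gt0.
have b0 : 0 < b by rewrite -(pmulr_rgt0 _ n0); apply: lt_le_trans dP; rewrite mulr_gt0.
have E0 : 0 < E by exact: lt_le_trans m0 mleE.
have ge0 := (ltW n0, ltW c0, ltW H0, ltW T00, ltW m0, ltW b0, ltW E0, ltW P0, ltW d0, ltW Y0).
have cH : 12 <= c * H by rewrite -[12]mulr1 ler_pM //; lra.
have ccH : c <= c * H by rewrite ler_peMr // ltW.
have cHY0 : 0 <= c * H * Y by rewrite !mulr_ge0 // ltW.
have mE2 : m * P * m <= b ^+ 2 * E * n ^+ 2.
  have -> : m * P * m = (d * P) ^+ 2 * m by rewrite mE; ring.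
  have -> : b ^+ 2 * E * n ^+ 2 = (n * b) ^+ 2 * E by ring.
  rewrite ler_pM ?(mulr_ge0, exprn_ge0, ge0) //.
  by rewrite ler_pXn2r ?nnegrE ?(mulr_ge0, exprn_ge0, ge0).
have [E8|E8] := leP E (8 * (n ^+ 2 * T0)).
  apply: (le_trans mleE); apply: (le_trans E8).
  apply: (@le_trans _ _ (12 * Y)); last by rewrite ler_wpM2r // ltW.
  by lra.
have hT : n ^+ 2 * (T0 * b ^+ 2) <= b ^+ 2 * E / 8.
  rewrite ler_pdivlMr //.
  have -> : n ^+ 2 * (T0 * b ^+ 2) * 8 = b ^+ 2 * (8 * (n ^+ 2 * T0)) by ring.
  by rewrite ler_wpM2l ?exprn_ge0 ?(ltW b0) // ltW.
have X0 : 0 < b ^+ 2 * E by rewrite mulr_gt0 // exprn_gt0.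
have [i1|i1] := leP (b ^+ 2 * E / 4) (n ^+ 3 * b).
  have bE : b * E <= 4 * n ^+ 3.
    rewrite -(ler_pM2l b0); have -> : b * (b * E) = b ^+ 2 * E by ring.
    by lra.
  have m3 : m ^+ 3 <= 4 * c * n ^+ 7.
    have dE : d * P * E <= 4 * n ^+ 4.
      apply: (@le_trans _ _ (n * b * E)); first by rewrite ler_wpM2r // ltW.
      have -> : 4 * n ^+ 4 = n * (4 * n ^+ 3) by ring.
      by rewrite -mulrA ler_wpM2l // ltW.
    have m2 : m ^+ 2 <= 4 * n ^+ 4 * d.
      apply: (@le_trans _ _ (d * P * E * d)); last by rewrite ler_wpM2r // ltW.
      have -> : d * P * E * d = m * E by rewrite mE; ring.
      by rewrite expr2 ler_wpM2l // ltW.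
    have -> : m ^+ 3 = m ^+ 2 * m by ring.
    apply: (@le_trans _ _ (4 * n ^+ 4 * d * m)); first by rewrite ler_wpM2r // ltW.
    have -> : 4 * n ^+ 4 * d * m = 4 * n ^+ 4 * (d ^+ 3 * P) by rewrite mE; ring.
    have -> : 4 * c * n ^+ 7 = 4 * n ^+ 4 * (c * n ^+ 3) by ring.
    by rewrite ler_wpM2l // mulr_ge0 // exprn_ge0 // ltW.
  apply: (@le_of_exp_le _ 2) => //; apply: (le_trans m3).
  rewrite exprMn; apply: (@le_trans _ _ (4 * c * Y ^+ 3)).
    rewrite ler_wpM2l  ?(mulr_ge0, exprn_ge0, ge0) //; apply: le_trans Y3.
    by rewrite ler_peMr // exprn_ge0 // ltW.
  rewrite ler_wpM2r ?exprn_ge0 ?(ltW Y0) //; move: (c * H) cH ccH => u u12 cu.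
  have : 4 <= u ^+ 2 by nra.
  by rewrite (exprS _ 2) mulrC => u2; rewrite ler_pM //; lra.
have [i3|i3] := leP (b ^+ 2 * E / 4) (n ^+ 2 * lo).
  have h1 : (b ^+ 2 * E / 4) ^+ 2 <= E3 * (T0 * P ^+ 2 * E).
    apply: le_trans lole; rewrite ler_pXn2r ?nnegrE //.
      by rewrite ?(divr_ge0, mulr_ge0, exprn_ge0, ge0).
    by apply: le_trans i3; rewrite ?(divr_ge0, mulr_ge0, exprn_ge0, ge0).
  have h2 : (b ^+ 2 * E / 4) ^+ 2 <= 9 * c * n ^+ 3 * H * (T0 * P ^+ 2 * E).
    apply: (le_trans h1); rewrite ler_wpM2r //  ?(mulr_ge0, exprn_ge0, ge0) //.
  have h3 : m ^+ 2 * E * (P ^+ 2 * E) <= 144 * c * n ^+ 7 * H * T0 * (P ^+ 2 * E).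
    apply: (@le_trans _ _ (16 * n ^+ 4 * (b ^+ 2 * E / 4) ^+ 2)).
      have -> : m ^+ 2 * E * (P ^+ 2 * E) = (d * P) ^+ 4 * E ^+ 2 by rewrite mE; ring.
      have -> : 16 * n ^+ 4 * (b ^+ 2 * E / 4) ^+ 2 = (n * b) ^+ 4 * E ^+ 2 by field.
      rewrite ler_wpM2r ?exprn_ge0 ?(ltW E0) // ler_pXn2r ?nnegrE ?(mulr_ge0, exprn_ge0, ge0) //.
    have -> : 144 * c * n ^+ 7 * H * T0 * (P ^+ 2 * E) =
      16 * n ^+ 4 * (9 * c * n ^+ 3 * H * (T0 * P ^+ 2 * E)) by ring.
    by rewrite ler_wpM2l // mulr_ge0 // exprn_ge0 // ltW.
  rewrite ler_pM2r ?mulr_gt0 ?exprn_gt0 // in h3.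
  have m3 : m ^+ 3 <= 144 * (c * H) * Y ^+ 3.
    apply: (@le_trans _ _ (m ^+ 2 * E)); first by rewrite exprSr ler_wpM2l ?(mulr_ge0, exprn_ge0, ge0).
    apply: (le_trans h3).
    have -> : 144 * c * n ^+ 7 * H * T0 = 144 * (c * H) * (n ^+ 7 * T0) by ring.
    by rewrite ler_wpM2l // mulr_ge0 //; lra.
  apply: (@le_of_exp_le _ 2) => //; apply: (le_trans m3); rewrite exprMn.
  rewrite ler_wpM2r ?exprn_ge0 ?(ltW Y0) //; move: (c * H) cH => u u12.
  have : 144 <= u ^+ 2 by nra.
  by rewrite (exprS _ 2) (mulrC u) => u2; rewrite ler_wpM2r //; lra.
set X := b ^+ 2 * E in X0 hT i1 i3 hi mE2.
have hw w : 0 < w ->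
    X / 4 < n ^+ 2 * H * (c * w ^+ 2 * P ^+ 2) + 3 * c * n ^+ 4 * H ^+ 2 / w.
  move=> w0; have := hi w w0.
  have -> : n ^+ 2 * (n * b + lo + T0 * b ^+ 2 +
      H * (c * w ^+ 2 * P ^+ 2 + 3 * c * n ^+ 2 * H / w)) =
      n ^+ 3 * b + n ^+ 2 * lo + n ^+ 2 * (T0 * b ^+ 2) +
      (n ^+ 2 * H * (c * w ^+ 2 * P ^+ 2) + 3 * c * n ^+ 4 * H ^+ 2 / w).
    by field; rewrite gt_eqF.
  by move: (n ^+ 2 * (T0 * b ^+ 2)) hT => u; lra.
(* This [w] makes the second term of [hw] equal to X / 8, so that the first one must reach X / 8. *)
pose w := 24 * c * n ^+ 4 * H ^+ 2 / X.
have w0 : 0 < w by rewrite !mulr_gt0 ?invr_gt0 ?exprn_gt0.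
have hX : X ^+ 3 <= 4608 * c ^+ 3 * n ^+ 10 * H ^+ 5 * P ^+ 2.
  have h1 : 3 * c * n ^+ 4 * H ^+ 2 / w = X / 8.
    by rewrite /w; field; rewrite !gt_eqF // !mulr_gt0 ?exprn_gt0.
  have h2 : X / 8 <= n ^+ 2 * H * (c * w ^+ 2 * P ^+ 2).
    by have := hw w w0; rewrite h1; lra.
  have -> : 4608 * c ^+ 3 * n ^+ 10 * H ^+ 5 * P ^+ 2 =
      8 * X ^+ 2 * (n ^+ 2 * H * (c * w ^+ 2 * P ^+ 2)).
    by rewrite /w; field; rewrite gt_eqF.
  have -> : X ^+ 3 = 8 * X ^+ 2 * (X / 8) by field.
  by rewrite ler_wpM2l // mulr_ge0 // exprn_ge0 // ltW.
have m6 : m ^+ 6 * P <= 4608 * c ^+ 3 * n ^+ 16 * H ^+ 5.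
  rewrite -(ler_pM2r (_ : 0 < P ^+ 2)) ?exprn_gt0 //.
  have -> : m ^+ 6 * P * P ^+ 2 = (m * P * m) ^+ 3 by ring.
  apply: (@le_trans _ _ ((X * n ^+ 2) ^+ 3)).
    rewrite ler_pXn2r ?nnegrE  ?(mulr_ge0, exprn_ge0, ge0) //.
  have -> : 4608 * c ^+ 3 * n ^+ 16 * H ^+ 5 * P ^+ 2 =
     (4608 * c ^+ 3 * n ^+ 10 * H ^+ 5 * P ^+ 2) * n ^+ 6 by ring.
  rewrite exprMn -exprM ler_wpM2r // exprn_ge0 // ltW //.
have m3 : m ^+ 3 <= c ^+ 2 * n ^+ 6 * P.
  have -> : m ^+ 3 = (d ^+ 3 * P) ^+ 2 * P by rewrite mE; ring.
  have -> : c ^+ 2 * n ^+ 6 = (c * n ^+ 3) ^+ 2 by ring.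
  by rewrite ler_wpM2r ?(ltW P0) // ler_pXn2r ?nnegrE  ?(mulr_ge0, exprn_ge0, ge0).
apply: (@le_of_exp_le _ 8) => //.
have -> : m ^+ 9 = m ^+ 6 * m ^+ 3 by ring.
apply: (@le_trans _ _ (m ^+ 6 * (c ^+ 2 * n ^+ 6 * P))).
  by rewrite ler_wpM2l // exprn_ge0 // ltW.
have -> : m ^+ 6 * (c ^+ 2 * n ^+ 6 * P) = m ^+ 6 * P * (c ^+ 2 * n ^+ 6) by ring.
apply: (@le_trans _ _ (4608 * c ^+ 3 * n ^+ 16 * H ^+ 5 * (c ^+ 2 * n ^+ 6))).
  by rewrite ler_wpM2r //  ?(mulr_ge0, exprn_ge0, ge0).
have -> : 4608 * c ^+ 3 * n ^+ 16 * H ^+ 5 * (c ^+ 2 * n ^+ 6) =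
   4608 * (c * H) ^+ 5 * n ^+ 22 by ring.
have cH0 : 0 <= c * H by rewrite mulr_ge0 ?ge0.
apply: (@le_trans _ _ ((c * H) ^+ 9 * n ^+ 22)); last first.
  by rewrite (exprMn 9 (c * H) Y) ler_wpM2l // exprn_ge0.
rewrite ler_wpM2r ?exprn_ge0 ?(ltW n0) //.
move: (c * H) cH => u u12; clear -u12.
have -> : u ^+ 9 = (u ^+ 2) ^+ 2 * u ^+ 5 by ring.
have u2 : 144 <= u ^+ 2 by nra.
have u4 : 4608 <= (u ^+ 2) ^+ 2 by nra.
by apply: ler_wpM2r => //; rewrite exprn_ge0 //; lra.
Qed.

(** * Summation over the levels *)

Definition harmonic (R : realFieldType) (n : nat) : R := \sum_(t < n) t.+1%:R^-1.

Lemma cube_le_sum (m : nat) : (m ^ 3 <= \sum_(t < m) 3 * t.+1 ^ 2)%N.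
Proof.
elim: m => [|m IH]; first by rewrite big_ord0.
rewrite big_ord_recr /=; apply: leq_trans (leq_add IH (leqnn _)).
have -> : (m.+1 ^ 3 = m ^ 3 + 3 * m ^ 2 + 3 * m + 1)%N by rewrite -addn1; ring.
have -> : (m.+1 ^ 2 = m ^ 2 + 2 * m + 1)%N by rewrite -addn1; ring.
by lia.
Qed.

Lemma sum_ltn_le (n m : nat) : (\sum_(t < n) (t < m) <= m)%N.
Proof.
suff -> : (\sum_(t < n) (t < m) = minn n m)%N by exact: geq_minr.
elim: n => [|n IH]; first by rewrite big_ord0 min0n.
by rewrite big_ord_recr /= IH; lia.
Qed.

Section EnergyBound.
Context (R : realFieldType) (F : finFieldType) (p n : nat).
Hypothesis charp : p \in [pchar F].
Hypothesis n_gt0 : (0 < n)%N.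
Hypothesis np : (n ^ 3 <= p ^ 2)%N.
Local Notation G := (mu_set F n).
Local Notation D := (popular_diffs F n).
Hypothesis cardG : #|G| = n.
Local Notation T0 := (threshold p n).
Local Notation H := (harmonic R n).
Local Notation c := (48 ^+ 3 : R).

Lemma harmonic_ge1 : 1 <= H.
Proof.
rewrite /harmonic; case: n n_gt0 => // k _; rewrite big_ord_recl invr1 lerDl.
by apply: sumr_ge0 => i _; rewrite invr_ge0.
Qed.

(** As n^3 <= p^2 amounts to (n^2 / p)^2 <= n, the threshold is O(n^(1/2)). Levels below it then
    contribute only O(n^3) to the third energy. *)
Lemma threshold_sqr_le : (T0%:R : R) ^+ 2 <= 225 ^+ 2 * (4 * n%:R).
Proof.
have p0 : (0 < p)%N by rewrite prime_gt0 // (pcharf_prime charp).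
have q2 := sqr_divn_le p0 np.
have : ((n ^ 2 %/ p).+1 ^ 2 <= 4 * n)%N.
  by move: q2 n_gt0; move: (n ^ 2 %/ p)%N => q; rewrite -!mulnn; nia.
rewrite -(ler_nat R) natrX (natrM _ 4) => h.
by rewrite /threshold natrM exprMn ler_wpM2l ?exprn_ge0.
Qed.

Lemma popular_diffs_le (t : nat) : (T0 <= t)%N ->
  t%:R ^+ 3 * #|D t|%:R <= c * n%:R ^+ 3.
Proof.
move=> Tt; have := card_popular_diffs n_gt0 charp np Tt.
by rewrite -(ler_nat R) (natrM _ (t ^ 3)%N) (natrM _ (48 ^ 3)%N) !natrX.
Qed.

Lemma sum_popular_diffs_le : \sum_(t < n) #|D t.+1|%:R <= n%:R ^+ 2 :> R.
Proof.
rewrite -natr_sum -natrX ler_nat -[X in (_ <= X ^ 2)%N]cardG -sum_rep [leqRHS](bigD1 0) //=.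
apply: leq_trans (leq_addl _ _).
have -> : (\sum_(t < n) #|D t.+1| = \sum_(t < n) 1 * #|D t.+1|)%N.
  by apply: eq_bigr => t _; rewrite mul1n.
rewrite -(sum_popular cardG (fun=> 1%N)).
by apply: leq_sum => x _; rewrite sum1_card card_ord.
Qed.

(** At levels t >= [T0], t^2 |D t| <= c n^3 / t sums to a harmonic number; below, t^2 <= T0^2 and
    the total number n^2 of representations suffice. The factor 9 c absorbs 1 + 12 * 225^2 + 3 c. *)
Lemma third_energy_le : (third_energy F n)%:R <= 9 * c * n%:R ^+ 3 * H.
Proof.
pose N : R := n%:R; pose T : R := T0%:R.
have N0 : 0 <= N by [].
have H1 := harmonic_ge1.
have h1 : (third_energy F n <= n ^ 3 + \sum_(t < n) 3 * t.+1 ^ 2 * #|D t.+1|)%N.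
  rewrite /third_energy (bigD1 0) //= rep0 cardG leq_add2l.
  rewrite -(sum_popular cardG (fun t => 3 * t.+1 ^ 2)%N).
  by apply: leq_sum => x _; exact: cube_le_sum.
have h2 : (\sum_(t < n) 3 * t.+1 ^ 2 * #|D t.+1|)%:R <=
    3 * T ^+ 2 * N ^+ 2 + 3 * c * N ^+ 3 * H.
  apply: (@le_trans _ _ (\sum_(t < n)
      (3 * T ^+ 2 * #|D t.+1|%:R + 3 * c * N ^+ 3 * t.+1%:R^-1))).
    rewrite natr_sum; apply: ler_sum => t _.
    rewrite (natrM _ (3 * t.+1 ^ 2)%N) (natrM _ 3) natrX.
    have [tT|/ltnW tT] := leqP T0 t.+1.
      rewrite ler_wpDl ?mulr_ge0 ?exprn_ge0 //.
      rewrite ler_pdivlMr ?ltr0n //.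
      have -> : 3%:R * t.+1%:R ^+ 2 * #|D t.+1|%:R * t.+1%:R =
        3 * (t.+1%:R ^+ 3 * #|D t.+1|%:R) :> R by ring.
      rewrite -(mulrA 3 c) ler_wpM2l //; exact: popular_diffs_le.
    rewrite ler_wpDr ?(mulr_ge0, exprn_ge0, invr_ge0) //.
    by rewrite ler_wpM2r // ler_wpM2l // lerXn2r ?nnegrE // ler_nat.
  rewrite big_split /= -!mulr_sumr lerD // ler_wpM2l ?sum_popular_diffs_le //.
  by rewrite mulr_ge0 ?exprn_ge0.
have h3 : T ^+ 2 * N ^+ 2 <= 225 ^+ 2 * (4 * N ^+ 3).
  have -> : N ^+ 3 = N * N ^+ 2 by ring.
  by rewrite (mulrA 4) (mulrA (225 ^+ 2)) ler_wpM2r ?exprn_ge0 // threshold_sqr_le.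
move: h1; rewrite -(ler_nat R) natrD natrX -/N => /le_trans; apply.
apply: (@le_trans _ _ (N ^+ 3 + (3 * T ^+ 2 * N ^+ 2 + 3 * c * N ^+ 3 * H))).
  by rewrite lerD2l.
have hH : N ^+ 3 <= N ^+ 3 * H by rewrite ler_peMr // exprn_ge0.
have e1 : 3 * c * N ^+ 3 * H = 3 * c * (N ^+ 3 * H) by ring.
have e2 : 9 * c * N ^+ 3 * H = 9 * c * (N ^+ 3 * H) by ring.
have e3 : 3 * T ^+ 2 * N ^+ 2 = 3 * (T ^+ 2 * N ^+ 2) by ring.
rewrite e1 e2 e3; have N30 : 0 <= N ^+ 3 by rewrite exprn_ge0.
move: (N ^+ 3 * H) h3 hH N30 => b; move: (T ^+ 2 * N ^+ 2) (N ^+ 3) => a d h3 hH N30.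
by lra.
Qed.

Lemma sum_cls_mult_cube_le (S : {set F * F}) :
  (forall s, s \in S -> (T0 <= cls_mult n s)%N) ->
  \sum_(s in S) (cls_mult n s)%:R ^+ 3 <= 3 * c * n%:R ^+ 2 * H.
Proof.
move=> ST.
have h1 : (\sum_(s in S) cls_mult n s ^ 3 <=
    \sum_(t < n) 3 * t.+1 ^ 2 * #|[set s in S | t < cls_mult n s]|)%N.
  rewrite -(@sum_layer _ S (cls_mult n) (fun t => 3 * t.+1 ^ 2)%N n); last first.
    by move=> s _; exact: cls_mult_le.
  by apply: leq_sum => s _; exact: cube_le_sum.
under eq_bigr => s _ do rewrite -natrX.
rewrite -natr_sum; move: h1; rewrite -(ler_nat R) => /le_trans; apply.
rewrite natr_sum mulr_sumr; apply: ler_sum => t _.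
rewrite ler_pdivlMr ?ltr0n // -[n%:R ^+ 2]natrX -[c]natrX -!natrM ler_nat.
set k := #|_|.
have -> : (3 * t.+1 ^ 2 * k * t.+1 = 3 * (t.+1 ^ 3 * k))%N by ring.
rewrite -(mulnA 3%N (48 ^ 3)%N) leq_mul2l; apply/orP; right.
(* Every class of [S] has at least [T0] elements, so the level sets of [S] are constant up to [T0]
   and the bound at [T0] serves for all of them. *)
pose u := maxn t.+1 T0.
have uT : (T0 <= u)%N by exact: leq_maxr.
apply: leq_trans (card_popular_classes charp n_gt0 np uT).
rewrite leq_mul ?leq_exp2r ?leq_maxl //; apply: subset_leq_card.
apply/subsetP => s; rewrite !inE => /andP[sS ts].
by rewrite geq_max ts ST.
Qed.

(** Levels up to [T0] are charged with all pairs of B. Beyond, a class of size x enters through x^2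
    <= v^2 + x^3 / v: the first term is controlled by the number of classes, the second by the third
    moment. *)
Lemma high_pairs_le (P : {set F}) (w : R) : 0 \notin P ->
  (forall u x, u \in G -> x \in P -> u * x \in P) -> 0 < w ->
  (\sum_(bc in high_pairs n P T0) rep n (bc.1 - bc.2)%R)%:R <=
    T0%:R * #|unit_shift n P|%:R ^+ 2 +
    H * (c * w ^+ 2 * #|P|%:R ^+ 2 + 3 * c * n%:R ^+ 2 * H / w).
Proof.
move=> P0 PG w0; set b : R := #|unit_shift n P|%:R.
set K := c * w ^+ 2 * _ + _.
have H1 := harmonic_ge1.
have H0 : 0 <= H by lra.
have K0 : 0 <= K.
  by rewrite addr_ge0 // !mulr_ge0 ?exprn_ge0 ?invr_ge0 // ltW.
have -> : (\sum_(bc in high_pairs n P T0) rep n (bc.1 - bc.2)%R =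
   \sum_(t < n) #|[set bc in high_pairs n P T0 | (bc.1 - bc.2)%R \in D t.+1]|)%N.
  under eq_bigr => bc _ do rewrite -[rep _ _]card_ord -sum1_card.
  rewrite (@sum_layer _ (high_pairs n P T0) (fun bc => rep n (bc.1 - bc.2)) (fun=> 1%N) n); last first.
    by move=> x _; rewrite -[leqRHS]cardG rep_le.
  apply: eq_bigr => t _; rewrite mul1n; apply: eq_card => -[x y].
  rewrite [LHS]inE [RHS]inE; case: (boolP ((x, y) \in high_pairs n P T0)) => //= /setIdP[_ /andP[xy _]].
  by rewrite inE subr_eq0 xy.
rewrite natr_sum.
apply: (@le_trans _ _ (\sum_(t < n) ((t < T0)%:R * b ^+ 2 + t.+1%:R^-1 * K))); last first.
  rewrite big_split /= -!mulr_suml lerD2r ler_wpM2r ?exprn_ge0 //.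
  by rewrite -natr_sum ler_nat sum_ltn_le.
apply: ler_sum => t _; have [tT|Tt] := ltnP t T0.
  rewrite mul1r ler_wpDr ?mulr_ge0 ?invr_ge0 //.
  rewrite -natrX ler_nat -mulnn -cardsX; apply: subset_leq_card.
  by apply/subsetP => bc; rewrite inE => /andP[]; rewrite inE => /andP[].
rewrite mul0r add0r.
have [S [Sn ST hi]] := card_high_pairs_le n_gt0 cardG P0 PG T0 t.+1.
(* A cutoff proportional to the level makes both terms decay like 1/t, because the number of classes
   is O(|P|^2 / t^3); [w] stays free for a later choice. *)
pose v := t.+1%:R * w.
have v0 : 0 < v by rewrite mulr_gt0 // ltr0n.
apply: (@le_trans _ _ (\sum_(s in S) (v ^+ 2 + (cls_mult n s)%:R ^+ 3 / v))).
  move: hi; rewrite -(ler_nat R) natr_sum => /le_trans; apply.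
  apply: ler_sum => s _; rewrite natrX; move: (_%:R) (ler0n R (cls_mult n s)) => x x0.
  have [xv|/ltW vx] := leP x v.
    rewrite ler_wpDr ?divr_ge0 ?exprn_ge0 ?(ltW v0) //.
    by rewrite ler_pXn2r ?nnegrE // ltW.
  rewrite ler_wpDl ?exprn_ge0 ?(ltW v0) // ler_pdivlMr // (exprSr _ 2).
  by rewrite ler_wpM2l // exprn_ge0.
rewrite big_split /= sumr_const -[v ^+ 2 *+ _]mulr_natr /K mulrDr; apply: lerD; last first.
  have -> : t.+1%:R^-1 * (3 * c * n%:R ^+ 2 * H / w) = 3 * c * n%:R ^+ 2 * H / v.
    by rewrite /v (invfM t.+1%:R w) mulrCA.
  have -> : \sum_(s in S) (cls_mult n s)%:R ^+ 3 / v =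
      (\sum_(s in S) (cls_mult n s)%:R ^+ 3) / v by rewrite mulr_suml.
  rewrite ler_wpM2r ?invr_ge0 ?(ltW v0) //.
  exact: sum_cls_mult_cube_le.
have n30 : 0 < n%:R ^+ 3 :> R by rewrite exprn_gt0 // ltr0n.
have t30 : 0 < t.+1%:R ^+ 3 :> R by rewrite exprn_gt0 // ltr0n.
rewrite -(ler_pM2r n30) -(ler_pM2r t30).
move: Sn; rewrite -(ler_nat R) !(natrX, natrM) => Sn.
have hD := popular_diffs_le (leqW Tt).
apply: (@le_trans _ _ (t.+1%:R ^+ 5 * w ^+ 2 * (#|P|%:R ^+ 2 * #|D t.+1|%:R))).
  have -> : v ^+ 2 * #|S|%:R * n%:R ^+ 3 * t.+1%:R ^+ 3 =
     t.+1%:R ^+ 5 * w ^+ 2 * (n%:R ^+ 3 * #|S|%:R) by rewrite /v; ring.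
  by rewrite ler_wpM2l // mulr_ge0 ?exprn_ge0 // ltW.
have -> : t.+1%:R ^+ 5 * w ^+ 2 * (#|P|%:R ^+ 2 * #|D t.+1|%:R) =
   t.+1%:R ^+ 2 * w ^+ 2 * #|P|%:R ^+ 2 * (t.+1%:R ^+ 3 * #|D t.+1|%:R) by ring.
have -> : t.+1%:R^-1 * (c * w ^+ 2 * #|P|%:R ^+ 2) * n%:R ^+ 3 * t.+1%:R ^+ 3 =
   t.+1%:R ^+ 2 * w ^+ 2 * #|P|%:R ^+ 2 * (c * n%:R ^+ 3).
  have e (y u z : R) : y != 0 -> y^-1 * u * z * y ^+ 3 = y ^+ 2 * (u * z).
    by move=> y0; field.
  by rewrite e ?pnatr_eq0 //; ring.
by rewrite ler_wpM2l // !mulr_ge0 ?exprn_ge0 // ltW.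
Qed.

(** A level t >= [T0] contributes at most 2 t |D t| <= 2 c H Y / t by the mass bound, whence the
    second factor H; the lower levels contribute at most 2 T0 n^2, which is again O(Y). *)
Lemma energy_le (Y : R) : 0 < Y ->
  n%:R ^+ 22 <= Y ^+ 9 -> n%:R ^+ 7 * T0%:R <= Y ^+ 3 -> n%:R ^+ 2 * T0%:R <= Y ->
  (energy F n)%:R <= 3 * c * H ^+ 2 * Y.
Proof.
move=> Y0 Y9 Y3 Y1.
pose N : R := n%:R; pose T : R := T0%:R; pose d t : R := #|D t|%:R.
have H1 := harmonic_ge1.
have N0 : 0 < N by rewrite ltr0n.
have T1 : 1 <= T by rewrite ler1n.
have mass t : (T0 <= t)%N -> t%:R ^+ 2 * d t <= c * H * Y.
  move=> Tt; have t0 : (0 < t)%N by exact: leq_trans Tt.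
  rewrite /d; have [->|Dt0] := posnP #|D t|.
    by rewrite mulr0 !mulr_ge0 ?exprn_ge0 ?(ltW Y0) //; lra.
  have P0 := popular_diffs_neq0 F n t.
  have PN := @popular_diffsN F n t.
  have PG := fun u x => @popular_diffs_stable F n n_gt0 t u x.
  have lo := low_sum_le n_gt0 cardG P0 PG T0.
  have ge := unit_shift_energy_ge n_gt0 cardG PN PG.
  have sp := unit_shift_energy_split cardG (D t) T0.
  have sr := sum_rep_popular n_gt0 cardG PG.
  apply: (@popular_mass_le R c N T #|unit_shift n (D t)|%:R (energy F n)%:R
    (third_energy F n)%:R (low_sum n (D t) T0)%:R H _ t%:R #|D t|%:R Y) => //.
  - by lra.
  - by rewrite ltr0n.
  - by rewrite ltr0n.
  - rewrite -natrX -natrM ler_nat mulnC -sum_nat_const /energy.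
    rewrite [leqLHS]big_mkcond; apply: leq_sum => x _; case: ifP => //.
    by rewrite inE => /andP[_ tx]; rewrite leq_exp2r.
  - rewrite -!natrM ler_nat sr mulnC -sum_nat_const; apply: leq_sum => x.
    by rewrite inE => /andP[].
  - exact: popular_diffs_le.
  - exact: third_energy_le.
  - move: lo; rewrite -(ler_nat R) !(natrX, natrM) => lo.
    by rewrite /T /threshold natrM.
  - move=> w w0; have := high_pairs_le P0 PG w0; rewrite -/N -/T => hi.
    move: ge; rewrite -(ler_nat R) sp !(natrX, natrM, natrD) => /le_trans; apply.
    by rewrite ler_wpM2l ?exprn_ge0 ?(ltW N0) // -[leRHS]addrA lerD2l.
have -> : (energy F n = n ^ 2 + \sum_(t < n) (2 * t + 1) * #|D t.+1|)%N.
  rewrite /energy (bigD1 0) //= rep0 cardG -(sum_popular cardG (fun t => 2 * t + 1)%N).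
  by congr (_ + _)%N; apply: eq_bigr => x _; rewrite sum_odd.
rewrite natrD natrX natr_sum -/N.
have h : \sum_(t < n) ((2 * t + 1) * #|D t.+1|)%:R <=
    2 * T * N ^+ 2 + H * (2 * (c * H * Y)).
  apply: (@le_trans _ _ (\sum_(t < n) (2 * T * d t.+1 + t.+1%:R^-1 * (2 * (c * H * Y))))).
    apply: ler_sum => t _; rewrite natrM -/(d t.+1).
    have t2 : (2 * t + 1)%:R <= 2 * t.+1%:R :> R.
      by rewrite -natrM ler_nat; lia.
    have d0 : 0 <= d t.+1 by [].
    apply: (@le_trans _ _ (2 * t.+1%:R * d t.+1)); first by rewrite ler_wpM2r.
    have [Tt|tT] := leqP T0 t.+1.
      rewrite ler_wpDl ?mulr_ge0 ?(le_trans _ T1) //.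
      rewrite [leRHS]mulrC ler_pdivlMr ?ltr0n //.
      have := mass _ Tt; have -> : 2 * t.+1%:R * d t.+1 * t.+1%:R =
        2 * (t.+1%:R ^+ 2 * d t.+1) by ring.
      by move=> m; rewrite ler_wpM2l.
    rewrite ler_wpDr ?mulr_ge0 ?exprn_ge0 ?invr_ge0 ?(ltW Y0) //; first lra.
    by rewrite ler_wpM2r // ler_wpM2l // ler_nat ltnW.
  rewrite big_split /= -mulr_sumr -mulr_suml lerD2r ler_wpM2l ?sum_popular_diffs_le //.
  by rewrite mulr_ge0 // (le_trans _ T1).
have N2 : N ^+ 2 <= N ^+ 2 * T by rewrite ler_peMr // exprn_ge0 // ltW.
have e : H * (2 * (c * H * Y)) = 2 * c * (H ^+ 2 * Y) by ring.
have hY : Y <= H ^+ 2 * Y by rewrite ler_peMl ?exprn_ege1 // ltW.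
have -> : 3 * c * H ^+ 2 * Y = 3 * c * (H ^+ 2 * Y) by ring.
apply: (le_trans (lerD (lexx _) h)); rewrite e.
have -> : 2 * T * N ^+ 2 = 2 * (N ^+ 2 * T) by ring.
move: Y1 N2 hY; rewrite -/N -/T.
move: (N ^+ 2 * T) => a; move: (H ^+ 2 * Y) (N ^+ 2) => b q; lra.
Qed.

End EnergyBound.

(** * Binomial exponential sums *)

Lemma expr_gcdn_eq1 (F : fieldType) (m n : nat) (x : F) : (0 < m)%N ->
  x ^+ m = 1 -> x ^+ n = 1 -> x ^+ gcdn m n = 1.
Proof.
move=> m0 xm xn; case: (egcdnP n m0) => km kn e _.
have := congr1 (fun k => x ^+ k) e => /=.
by rewrite exprD mulnC exprM xm expr1n mulnC exprM xn expr1n mul1r => <-.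
Qed.

Lemma finField_expf_eq1 (F : finFieldType) (x : F) : x != 0 -> x ^+ #|F|.-1 = 1.
Proof.
move=> x0; apply: (mulfI x0); rewrite mulr1 -exprS prednK ?expf_card //.
by apply/card_gt0P; exists x.
Qed.

(** Two solutions with y nonzero differ by a factor whose powers m and |F| - 1 are both 1, hence a
    root of unity for the gcd of these exponents. *)
Lemma card_expr_eq_gcd_le (F : finFieldType) (m : nat) (y : F) : (0 < m)%N ->
  (#|[set x : F | x ^+ m == y]| <= gcdn m #|F|.-1)%N.
Proof.
move=> m0; set h := gcdn _ _; have h0 : (0 < h)%N by rewrite gcdn_gt0 m0.
have [->|y0] := eqVneq y 0.
  apply: leq_trans h0; rewrite -(cards1 (0 : F)); apply: subset_leq_card.
  by apply/subsetP => x; rewrite !inE expf_eq0 m0.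
have [->|[x0]] := set_0Vmem [set x : F | x ^+ m == y]; first by rewrite cards0.
rewrite inE => /eqP xy; have x00 : x0 != 0.
  by apply: contraNneq y0 => x0E; rewrite -xy x0E expr0n eqn0Ngt m0 eqxx.
apply: leq_trans (card_expr_eq_le 1 h0).
have xV0 : x0^-1 != 0 by rewrite invr_eq0.
rewrite -(card_imset _ (mulIf xV0)); apply: subset_leq_card.
apply/subsetP => _ /imsetP[x + ->]; rewrite !inE => /eqP xm.
have xn0 : x != 0 by apply: contraNneq y0 => xE; rewrite -xm xE expr0n eqn0Ngt m0 eqxx.
apply/eqP/expr_gcdn_eq1 => //; last by rewrite finField_expf_eq1 // mulf_neq0.
by rewrite exprMn exprVn xm xy divff.
Qed.

(** Pigeonhole: with nk = |F| - 1, the map x^k sends the nk nonzero elements into G with fibres of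
    at most k elements. *)
Lemma card_mu_set (F : finFieldType) (n : nat) : (0 < n)%N -> (n %| #|F|.-1)%N ->
  #|mu_set F n| = n.
Proof.
move=> n0 /dvdnP[k kn]; apply/eqP; rewrite eqn_leq card_expr_eq_le //=.
have F1 : (0 < #|F|.-1)%N.
  by rewrite -ltnS prednK; [exact: card_finNzRing_gt1|apply/card_gt0P; exists 0].
have k0 : (0 < k)%N by move: F1; rewrite kn; case: (k).
have h : (#|[set x : F | x != 0%R]| <= #|mu_set F n| * k)%N.
  apply: (card_le_fibers (f := fun x : F => x ^+ k)).
    by move=> x; rewrite !inE -exprM -kn => /finField_expf_eq1 ->.
  move=> y _; apply: leq_trans (card_expr_eq_le y k0).
  by apply: subset_leq_card; apply/subsetP => x; rewrite !inE => /andP[].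
have c : #|[set x : F | x != 0%R]| = #|F|.-1.
  by rewrite -(cardC1 (0 : F)); apply: eq_card => x; rewrite !inE.
by move: h; rewrite c kn mulnC leq_pmul2r.
Qed.

Lemma sum_sqr_le (C : numDomainType) (I : finType) (f : I -> C) :
  (forall i, f i \is Num.real) ->
  (\sum_i f i) ^+ 2 <= #|I|%:R * \sum_i f i ^+ 2.
Proof.
move=> fr; rewrite -(ler_pM2l (ltr0n C 2)).
have -> : 2%:R * (#|I|%:R * \sum_i f i ^+ 2) = \sum_i \sum_j (f i ^+ 2 + f j ^+ 2).
  under [RHS]eq_bigr => i _ do rewrite big_split /= sumr_const.
  have e (k : nat) (y : C) : 2%:R * (k%:R * y) = y *+ k + y *+ k.
    by rewrite -[y *+ k]mulr_natl; ring.
  by rewrite e big_split /= sumr_const -sumrMnl.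
rewrite expr2 big_distrlr /= mulr_sumr; apply: ler_sum => i _.
rewrite mulr_sumr; apply: ler_sum => j _; rewrite -subr_ge0.
have -> : f i ^+ 2 + f j ^+ 2 - 2%:R * (f i * f j) = (f i - f j) ^+ 2 by ring.
by rewrite real_exprn_even_ge0 // rpredB.
Qed.

(** Hoelder's inequality with exponent 4, as the Cauchy-Schwarz inequality applied twice. *)
Lemma sum_pow4_le (C : numDomainType) (I : finType) (f : I -> C) :
  (forall i, 0 <= f i) ->
  (\sum_i f i) ^+ 4 <= #|I|%:R ^+ 3 * \sum_i f i ^+ 4.
Proof.
move=> f0; have h1 := sum_sqr_le (fun i => ger0_real (f0 i)).
have h2 : (\sum_i f i ^+ 2) ^+ 2 <= #|I|%:R * \sum_i f i ^+ 4.
  under [X in _ <= _ * X]eq_bigr => i _ do rewrite -[4%N]/(2 * 2)%N exprM.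
  by apply: sum_sqr_le => i; rewrite ger0_real ?exprn_ge0.
rewrite -[4%N]/(2 * 2)%N exprM.
apply: (@le_trans _ _ ((#|I|%:R * \sum_i f i ^+ 2) ^+ 2)).
  by rewrite lerXn2r // nnegrE ?exprn_ge0 ?mulr_ge0 ?sumr_ge0 // => i _; rewrite exprn_ge0.
rewrite exprMn (exprSr _ 2) -mulrA ler_wpM2l // exprn_ge0 //.
Qed.

Section AdditiveCharacter.
Context (C : numClosedFieldType) (F : finFieldType) (psi : F -> C).
Hypothesis psiD : forall x y, psi (x + y) = psi x * psi y.
Hypothesis psi_norm : forall x, `|psi x| = 1.
Hypothesis psi_nontriv : exists x, psi x != 1.

Lemma psi_neq0 (x : F) : psi x != 0.
Proof. by rewrite -normr_eq0 psi_norm oner_eq0. Qed.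

Lemma psi0 : psi 0 = 1.
Proof. by apply: (mulfI (psi_neq0 0)); rewrite -psiD addr0 mulr1. Qed.

Lemma psi_conj (x : F) : (psi x)^* = psi (- x).
Proof.
apply: (mulfI (psi_neq0 x)); rewrite -normCK psi_norm expr1n -psiD subrr.
by rewrite psi0.
Qed.

Lemma sum_psi (s : F) : \sum_x psi (x * s) = if s == 0 then #|F|%:R else 0.
Proof.
case: eqVneq => [->|s0].
  under eq_bigr => x _ do rewrite mulr0 psi0.
  by rewrite sumr_const.
have [y py] := psi_nontriv.
have : (psi y - 1) * \sum_x psi (x * s) = 0.
  rewrite mulrBl mul1r mulr_sumr; apply/eqP; rewrite subr_eq0; apply/eqP.
  rewrite [RHS](reindex (fun x => y / s + x)) /=; last first.
    by apply: onW_bij; exists (fun x => - (y / s) + x) => x; rewrite ?addKr ?addNKr.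
  by apply: eq_bigr => x _; rewrite mulrDl mulfVK // psiD.
by move=> /eqP; rewrite mulf_eq0 subr_eq0 (negbTE py) => /eqP.
Qed.

Lemma parseval (f : F -> C) :
  \sum_l `|\sum_s f s * psi (l * s)| ^+ 2 = #|F|%:R * \sum_s `|f s| ^+ 2.
Proof.
under eq_bigr => l _.
  rewrite normCK rmorph_sum /= big_distrlr /=.
  under eq_bigr => s _.
    under eq_bigr => s' _.
      rewrite rmorphM /= psi_conj mulrACA -psiD -mulrN -mulrDr.
      over.
    over.
  over.
rewrite exchange_big /= mulr_sumr; apply: eq_bigr => s _.
rewrite exchange_big /= (bigD1 s) //= -mulr_sumr sum_psi subrr eqxx.
rewrite big1 ?addr0 => [|s' ss']; first by rewrite normCK mulrC.
by rewrite -mulr_sumr sum_psi subr_eq0 eq_sym (negbTE ss') mulr0.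
Qed.

Context (n : nat).
Hypothesis n_gt0 : (0 < n)%N.
Local Notation G := (mu_set F n).
Hypothesis cardG : #|G| = n.

Definition mu_sum (l : F) : C := \sum_(u in G) psi (l * u).

(** The squared modulus is the Fourier transform of [rep], which is what lets Parseval's identity
    convert the fourth moment into the energy. *)
Lemma mu_sum_sqr (l : F) : `|mu_sum l| ^+ 2 = \sum_s (rep n s)%:R * psi (l * s).
Proof.
rewrite normCK rmorph_sum /= big_distrlr /=.
under [RHS]eq_bigr => s _ do rewrite repE natr_sum mulr_suml.
rewrite [RHS]exchange_big /=; apply: eq_bigr => u _.
rewrite [RHS](reindex (fun v => u - v)) /=; last by exists (fun v => u - v) => v _; rewrite subKr.
rewrite big_mkcond; apply: eq_bigr => v _; rewrite subKr.
case: (v \in G); last by rewrite mul0r.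
by rewrite psi_conj -psiD mul1r -mulrN -mulrDr.
Qed.

Lemma mu_sum_fourth_moment :
  \sum_l `|mu_sum l| ^+ 4 = #|F|%:R * (energy F n)%:R.
Proof.
under eq_bigr => l _ do rewrite -[4%N]/(2 * 2)%N exprM mu_sum_sqr.
transitivity (\sum_l `|\sum_s (rep n s)%:R * psi (l * s)| ^+ 2).
  by apply: eq_bigr => l _; rewrite -mu_sum_sqr normrX normr_id.
rewrite parseval /energy natr_sum; congr (_ * _); apply: eq_bigr => s _.
by rewrite normr_nat natrX.
Qed.

(** The change of variable x -> u x fixes the term in x^n and multiplies x^m by u^m; coprimality of
    m and n makes u -> u^m a permutation of G, so the sum over u is [mu_sum]. *)
Lemma mul_binomial_sum (m : nat) (a b : F) : (0 < m)%N -> coprime m n ->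
  n%:R * \sum_x psi (a * x ^+ m + b * x ^+ n) =
  \sum_x psi (b * x ^+ n) * mu_sum (a * x ^+ m).
Proof.
move=> m0 cop.
have inj : {in G &, injective (fun u : F => u ^+ m)}.
  move=> u v uG vG /= uv; have v0 := mu_set_neq0 n_gt0 vG.
  have : (u / v) ^+ gcdn m n = 1.
    apply: expr_gcdn_eq1 => //; rewrite exprMn exprVn.
      by rewrite uv divff // expf_neq0.
    by move: uG vG; rewrite !inE => /eqP -> /eqP ->; rewrite divr1.
  by rewrite (eqP cop) expr1 => /(congr1 ( *%R^~ v)); rewrite mulfVK // mul1r.
have img : [set u ^+ m | u in G] = G.
  apply/eqP; rewrite eqEcard card_in_imset // leqnn andbT.
  by apply/subsetP => _ /imsetP[u + ->]; rewrite !inE exprAC => /eqP ->; rewrite expr1n.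
rewrite -{1}cardG mulr_natl -sumr_const.
transitivity (\sum_(u in G) \sum_x psi (b * x ^+ n) * psi (a * x ^+ m * u ^+ m)).
  apply: eq_bigr => u uG; have u0 := mu_set_neq0 n_gt0 uG.
  rewrite (reindex (fun x => u * x)) /=; last first.
    by apply: onW_bij; exists (fun x => u^-1 * x) => x; rewrite ?mulKf ?mulVKf.
  apply: eq_bigr => x _; rewrite -psiD !exprMn.
  move: uG; rewrite inE => /eqP ->; rewrite mul1r addrC; congr (psi (_ + _)).
  by rewrite -mulrA (mulrC (u ^+ m)).
rewrite exchange_big /=; apply: eq_bigr => x _; rewrite -mulr_sumr; congr (_ * _).
by rewrite /mu_sum -[in RHS]img big_imset.
Qed.

Lemma binomial_sum_pow4_le (m : nat) (a b : F) : (0 < m)%N -> coprime m n -> a != 0 ->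
  n%:R ^+ 4 * `|\sum_x psi (a * x ^+ m + b * x ^+ n)| ^+ 4 <=
  #|F|%:R ^+ 4 * (gcdn m #|F|.-1)%:R * (energy F n)%:R.
Proof.
move=> m0 cop a0; set S := \sum_x _.
have h1 : n%:R * `|S| <= \sum_x `|mu_sum (a * x ^+ m)|.
  rewrite -[n%:R]normr_nat -normrM mul_binomial_sum //.
  apply: (le_trans (ler_norm_sum _ _ _)); apply: ler_sum => x _.
  by rewrite normrM psi_norm mul1r.
(* The gcd h enters here: each l equals a x^m for at most h values of x. *)
have h2 : \sum_x `|mu_sum (a * x ^+ m)| ^+ 4 <=
    (gcdn m #|F|.-1)%:R * \sum_l `|mu_sum l| ^+ 4.
  rewrite (partition_big (fun x => a * x ^+ m) xpredT) //= mulr_sumr.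
  apply: ler_sum => l _.
  under eq_bigr => x /eqP -> do over.
  rewrite sumr_const -[`|mu_sum l| ^+ 4 *+ _]mulr_natl ler_wpM2r ?exprn_ge0 // ler_nat.
  apply: leq_trans (card_expr_eq_gcd_le (a^-1 * l) m0); apply: subset_leq_card.
  by apply/subsetP => x; rewrite !inE => /eqP <-; rewrite mulKf.
rewrite -exprMn.
apply: (@le_trans _ _ ((\sum_x `|mu_sum (a * x ^+ m)|) ^+ 4)).
  by rewrite lerXn2r // nnegrE ?mulr_ge0 ?sumr_ge0.
apply: (le_trans (sum_pow4_le _)) => //.
apply: (@le_trans _ _ (#|F|%:R ^+ 3 * ((gcdn m #|F|.-1)%:R * (#|F|%:R * (energy F n)%:R)))).
  by rewrite -mu_sum_fourth_moment ler_wpM2l ?exprn_ge0.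
set e := (energy F n)%:R; set h := (gcdn _ _)%:R.
by rewrite (_ : _ * (h * _) = #|F|%:R ^+ 4 * h * e) //; ring.
Qed.

End AdditiveCharacter.

(** * Transfer to sums modulo a prime *)

Section PrimeField.
Context (R : realType) (p : nat).
Hypothesis pp : prime p.

Definition Fp_char (x : 'F_p) : R[i] := ep R p (x : nat)%:Z.

Lemma intr_Fp (z : int) : z%:~R = `|(z %% p%:Z)%Z|%N%:R :> 'F_p.
Proof.
have p0 : p%:Z != 0 by rewrite eqz_nat -lt0n prime_gt0.
rewrite {1}(divz_eq z p%:Z) intrD intrM -[p%:Z%:~R]/(p%:R) pchar_Fp_0 // mulr0 add0r.
by rewrite -{1}(gez0_abs (modz_ge0 z p0)).
Qed.

Lemma ep_Fp_char (z : int) : ep R p z = Fp_char z%:~R.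
Proof.
have p0 : p%:Z != 0 by rewrite eqz_nat -lt0n prime_gt0.
apply: ep_modz; first exact: prime_gt0.
rewrite intr_Fp val_Fp_nat // -modz_nat modz_mod.
by rewrite (gez0_abs (modz_ge0 z p0)) modz_mod.
Qed.

Lemma expiD (s t : R) : expi (s + t) = expi s * expi t.
Proof. by rewrite /expi cosD sinD; simpc; congr (_ +i* _)%C; ring. Qed.

Lemma epD (x y : int) : ep R p (x + y) = ep R p x * ep R p y.
Proof. by rewrite /ep intrD mulrDr mulrDl expiD. Qed.

Lemma Fp_charD (x y : 'F_p) : Fp_char (x + y) = Fp_char x * Fp_char y.
Proof.
rewrite [in RHS]/Fp_char -epD ep_Fp_char intrD; congr Fp_char.
by rewrite -!pmulrn !natr_Zp.
Qed.

Lemma Fp_char_norm (x : 'F_p) : `|Fp_char x| = 1.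
Proof. by rewrite normc_def /= cos2Dsin2 sqrtr1. Qed.

Lemma Fp_char_nontriv : exists x, Fp_char x != 1.
Proof.
exists 1; rewrite /Fp_char (_ : nat_of_ord (1 : 'F_p) = 1%N) // /ep /expi mulr1.
have p2 : 2%:R <= p%:R :> R by rewrite ler_nat prime_gt1.
have p0 : 0 < p%:R :> R by apply: lt_le_trans p2.
have pi0 := pi_gt0 R.
set t := 2 * trigo.pi / p%:R.
have t0 : 0 < t by rewrite divr_gt0 // mulr_gt0.
have tpi : t <= trigo.pi by rewrite ler_pdivrMr // mulrC ler_wpM2l // ltW.
(* For p = 2 the angle is pi, where the sine vanishes but the cosine is -1; for other p the sine is
   positive. *)
rewrite eq_complex /= negb_and; have [tpi'|tpi'] := eqVneq t trigo.pi.
  by rewrite tpi' cospi; apply/orP; left; lra.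
by apply/orP; right; rewrite gt_eqF // sin_gt0_pi // t0 lt_neqAle tpi'.
Qed.

Lemma binomial_sumE (m n : nat) (a b : int) :
  binomial_sum R p m n a b =
  \sum_(x : 'F_p) Fp_char (a%:~R * x ^+ m + b%:~R * x ^+ n).
Proof.
rewrite /binomial_sum -{1}(Fp_cast pp) big_mkord; apply: eq_bigr => x _.
by rewrite ep_Fp_char intrD !intrM !rmorphXn /= -[(_%:Z)%:~R]/((x : nat)%:R) natr_Zp.
Qed.

Lemma Mmax_pow4_le (m n : nat) : (0 < m)%N -> (0 < n)%N ->
  (n %| p - 1)%N -> gcdn m n = 1%N ->
  n%:R ^+ 4 * Mmax R p m n ^+ 4 <=
  p%:R ^+ 4 * (gcdn m (p - 1))%:R * (energy 'F_p n)%:R.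
Proof.
move=> m0 n0 np mn; have [[a [b [ab ->]]] _] := Mmax_is_max R m n pp.
have cF : #|'F_p| = p by exact: card_Fp.
have cG : #|mu_set 'F_p n| = n by rewrite card_mu_set // cF -subn1.
have a0 : a%:~R != 0 :> 'F_p.
  apply: contraL ab => /eqP a0; rewrite coprimezMl negb_and; apply/orP; left.
  have pz : p%:Z != 0 by rewrite eqz_nat -lt0n prime_gt0.
  have ap : (a %% p%:Z)%Z = 0.
    have := congr1 (@nat_of_ord _) a0; rewrite intr_Fp val_Fp_nat // modn_small.
      by move=> /eqP; rewrite absz_eq0 => /eqP.
    by rewrite -ltz_nat (gez0_abs (modz_ge0 a pz)) ltz_pmod // ltz_nat prime_gt0.
  rewrite /coprimez -gcdz_modl ap gcd0z eqz_nat absz_nat.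
  by apply/eqP => p1; move: (prime_gt1 pp); rewrite p1.
have := binomial_sum_pow4_le Fp_charD Fp_char_norm Fp_char_nontriv n0 cG b%:~R m0 (introT eqP mn) a0.
rewrite cF -subn1 -binomial_sumE => h.
rewrite -lecR !(rmorphM, rmorphXn) /= !rmorph_nat; exact: h.
Qed.

End PrimeField.

(** * Logarithmic losses and final exponents *)

Lemma harmonic_le_ln (R : realType) (n : nat) : (0 < n)%N ->
  harmonic R n <= 1 + ln (n%:R : R).
Proof.
case: n => // n _; elim: n => [|n IH].
  by rewrite /harmonic big_ord_recl big_ord0 invr1 ln1.
rewrite /harmonic big_ord_recr /=; apply: (@le_trans _ _ (1 + ln n.+1%:R + n.+2%:R^-1)).
  by rewrite lerD2r.
have n1 : 0 < n.+1%:R :> R by rewrite ltr0n.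
have n2 : 0 < n.+2%:R :> R by rewrite ltr0n.
rewrite -addrA lerD2l.
have -> : n.+1%:R = n.+2%:R * (1 + - n.+2%:R^-1) :> R.
  rewrite mulrDr mulrN divff ?gt_eqF // mulr1 -[n.+2%:R]natr1; ring.
have i1 : n.+2%:R^-1 < 1 :> R by rewrite invf_lt1 // ltr1n.
rewrite lnM ?posrE //; last by rewrite subr_gt0.
have := @le_ln1Dx R (- n.+2%:R^-1); rewrite ltrN2 => /(_ i1).
move=> h; rewrite -[leRHS]addr0 -addrA lerD2l.
by rewrite -[leRHS](addNr n.+2%:R^-1) lerD2r.
Qed.

(** Chosen so that p to this exponent is K^(1/4) exp(sqrt(ln p)): this exceeds the fourth root of K
    (1 + ln p)^2, and the exponent still tends to 0. *)
Definition log_loss (R : realType) (K : R) (p : nat) : R :=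
  ln K / 4 * (Num.sqrt (ln p%:R))^-1 ^+ 2 + (Num.sqrt (ln p%:R))^-1.

Lemma log_loss_cvg0 (R : realType) (K : R) :
  (log_loss K @ \oo --> (0 : R))%classic.
Proof.
pose s (p : nat) : R := (Num.sqrt (ln p%:R))^-1.
have s0 : (s @ \oo --> (0 : R))%classic.
  apply/cvgrPdist_lt => e e0; near=> p.
  have hp : expR (e^-1 ^+ 2) < p%:R by near: p; exact: nbhs_infty_gtr.
  have p0 : 0 < p%:R :> R by apply: lt_trans hp; exact: expR_gt0.
  have lp : e^-1 ^+ 2 < ln p%:R by rewrite -ltr_expR lnK.
  have e1 : 0 < e^-1 by rewrite invr_gt0.
  have sq : e^-1 < Num.sqrt (ln p%:R).
    by rewrite -[e^-1]ger0_norm ?(ltW e1) // -sqrtr_sqr ltr_sqrt // (lt_trans _ lp) // exprn_gt0.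
  rewrite sub0r normrN /s ger0_norm ?invr_ge0 ?sqrtr_ge0 //.
  by rewrite -[e]invrK ltf_pV2 // posrE (lt_trans e1).
have := cvgD (cvgM (cvg_cst (ln K / 4)) (cvgM s0 s0)) s0.
by rewrite !mulr0 addr0; exact.
Unshelve. all: by end_near.
Qed.

Lemma log_loss_pow4_ge (R : realType) (K : R) (p : nat) : 0 < K -> (1 < p)%N ->
  K * (1 + ln p%:R) ^+ 2 <= (p%:R `^ log_loss K p) ^+ 4.
Proof.
move=> K0 p1; set L := ln p%:R.
have L0 : 0 < L by rewrite ln_gt0 // ltr1n.
set u := Num.sqrt L.
have u0 : 0 < u by rewrite sqrtr_gt0.
have uL : u ^+ 2 = L by rewrite sqr_sqrtr // ltW.
have pn0 : p%:R != 0 :> R by rewrite pnatr_eq0 -lt0n ltnW.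
rewrite /powR (negbTE pn0) -expRM_natl /log_loss -/L -/u.
have -> : 4%:R * ((ln K / 4 * u^-1 ^+ 2 + u^-1) * L) = ln K + 4 * u.
  by rewrite -uL; field; rewrite gt_eqF.
rewrite expRD lnK ?posrE // ler_wpM2l ?(ltW K0) //.
have -> : 4 * u = (2 * u) + (2 * u) by ring.
rewrite expRD -expr2.
(* The quadratic term of the exponential suffices: (2u)^2 / 2! = 2L. *)
have e : 1 + L <= expR (2 * u).
  have := @expR_ge1Dxn R (2 * u) 1; rewrite mulr_ge0 ?(ltW u0) // => /(_ isT).
  apply: le_trans; rewrite lerD2l -uL -[2`!]/2%N; nra.
by rewrite lerXn2r // nnegrE ?expR_ge0 ?addr_ge0 // ltW.
Qed.

Lemma powR_pow4 (R : realType) (x a : R) : (x `^ a) ^+ 4 = x `^ (4 * a).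
Proof. by rewrite -powR_mulrn ?powR_ge0 // -powRrM mulrC. Qed.

(** The last two hypotheses say that Y is at least n^(22/9) and n^3 p^(-1/3). With n^3 <= p^2 they
    also give n^4 <= pY, which handles the n^2 / p part of the threshold in the condition n^2 T0 <=
    Y. *)
Lemma energy_Fp_le (R : realType) (p n : nat) (Y : R) :
  prime p -> (0 < n)%N -> (n %| p - 1)%N -> (n ^ 3 <= p ^ 2)%N -> 0 < Y ->
  n%:R ^+ 22 <= Y ^+ 9 -> n%:R ^+ 9 <= p%:R * Y ^+ 3 ->
  (energy 'F_p n)%:R <= 1350 * 48 ^+ 3 * (1 + ln (p%:R : R)) ^+ 2 * Y.
Proof.
move=> pp n0 np n3 Y0 Y9 Y3.
have cF : #|'F_p| = p by exact: card_Fp.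
have cG : #|mu_set 'F_p n| = n by rewrite card_mu_set // cF -subn1.
pose N : R := n%:R; pose P : R := p%:R; pose T : R := (threshold p n)%:R.
have N1 : 1 <= N by rewrite ler1n.
have P0 : 0 < P by rewrite ltr0n prime_gt0.
have N0 : 0 < N by lra.
have Yge0 := ltW Y0.
have TP : T * P <= 225 * (N ^+ 2 + P).
  rewrite /T /threshold natrM -mulrA ler_wpM2l // -[(_ %/ _).+1%:R]natr1 mulrDl mul1r lerD2r.
  by rewrite -natrM -natrX ler_nat leq_trunc_div.
have N3 : N ^+ 3 <= P ^+ 2 by rewrite -!natrX ler_nat.
have N7 : N ^+ 7 <= Y ^+ 3.
  apply: (@le_of_exp_le _ 2); rewrite ?exprn_ge0 // -!exprM.
  by apply: le_trans Y9; rewrite ler_weXn2l.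
have N2 : N ^+ 2 <= Y.
  apply: (@le_of_exp_le _ 8) => //; rewrite -exprM.
  by apply: le_trans Y9; rewrite ler_weXn2l.
have N4 : N ^+ 4 <= P * Y.
  apply: (@le_of_exp_le _ 2); first by rewrite mulr_ge0 // ltW.
  rewrite (exprMn 3 P Y) -exprM.
  have -> : N ^+ (4 * 3) = N ^+ 3 * N ^+ 9 by rewrite -exprD.
  have -> : P ^+ 3 * Y ^+ 3 = P ^+ 2 * (P * Y ^+ 3) by ring.
  by rewrite ler_pM ?exprn_ge0 ?(ltW N0).
(* Enlarging Y by 450 = 2 * 225 absorbs the threshold, since T P <= 225 (N^2 + P); then 1350 = 3 *
   450. *)
have [k kE] : exists k : R, k = 450 by exists 450.
have k1 : 1 <= k by rewrite kE; lra.
have k0 : 0 <= k by lra.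
have h7 : N ^+ 7 * T <= (k * Y) ^+ 3.
  rewrite -(ler_pM2r P0) -mulrA.
  apply: (@le_trans _ _ (N ^+ 7 * (225 * (N ^+ 2 + P)))).
    by rewrite ler_wpM2l // exprn_ge0 // ltW.
  apply: (@le_trans _ _ (k * (P * Y ^+ 3))).
    have -> : N ^+ 7 * (225 * (N ^+ 2 + P)) = 225 * (N ^+ 9 + P * N ^+ 7) by ring.
    have h : P * N ^+ 7 <= P * Y ^+ 3 by rewrite ler_wpM2l // ltW.
    move: h Y3; rewrite -/N -/P.
    by move: (P * N ^+ 7) (P * Y ^+ 3) (N ^+ 9) => u v w h Y3; rewrite kE; lra.
  have PY : 0 <= P * Y ^+ 3 by rewrite mulr_ge0 ?exprn_ge0 // ltW.
  have -> : (k * Y) ^+ 3 * P = k ^+ 3 * (P * Y ^+ 3) by ring.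
  by rewrite ler_wpM2r // -[X in X <= _]expr1 ler_weXn2l.
have h2 : N ^+ 2 * T <= k * Y.
  rewrite -(ler_pM2r P0) -mulrA.
  apply: (@le_trans _ _ (N ^+ 2 * (225 * (N ^+ 2 + P)))).
    by rewrite ler_wpM2l // exprn_ge0 // ltW.
  have -> : N ^+ 2 * (225 * (N ^+ 2 + P)) = 225 * (N ^+ 4 + P * N ^+ 2) by ring.
  have h : P * N ^+ 2 <= P * Y by rewrite ler_wpM2l // ltW.
  have -> : k * Y * P = k * (P * Y) by ring.
  by move: (P * N ^+ 2) (P * Y) (N ^+ 4) h N4 => u v w h N4; rewrite kE; lra.
have Y90 : N ^+ 22 <= (k * Y) ^+ 9.
  by apply: (le_trans Y9); rewrite lerXn2r ?nnegrE ?mulr_ge0 ?k0 // ler_peMl.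
have Yk : 0 < k * Y by rewrite mulr_gt0 // (lt_le_trans ltr01).
have E := energy_le (pchar_Fp pp) n0 n3 cG Yk Y90 h7 h2.
apply: (le_trans E).
have hH : harmonic R n <= 1 + ln P.
  apply: (le_trans (harmonic_le_ln R n0)); rewrite lerD2l ler_ln ?posrE // ler_nat.
  have := dvdn_leq _ np; rewrite subn_gt0 prime_gt1 // => /(_ isT) np1.
  by apply: (leq_trans np1); rewrite leq_subr.
have H1 : 1 <= harmonic R n by exact: harmonic_ge1.
have -> : 3 * 48 ^+ 3 * harmonic R n ^+ 2 * (k * Y) =
  1350 * 48 ^+ 3 * harmonic R n ^+ 2 * Y by rewrite kE; ring.
have : 0 <= 1350 * 48 ^+ 3 :> R by lra.
move: (1350 * 48 ^+ 3 : R) => c c0.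
by rewrite ler_wpM2r // ler_wpM2l // lerXn2r ?nnegrE //; lra.
Qed.

(** The value Y = expR e is the energy bound that the target exponents require: p^4 Y = (n n^a
    p^b)^4. In logarithms, the conditions of [energy_Fp_le] become the three linear inequalities on
    x and y. *)
Lemma Mmax_le_powR (R : realType) (p m n : nat) (a b : R) :
  prime p -> (0 < m)%N -> (0 < n)%N -> (n %| p - 1)%N -> gcdn m n = 1%N ->
  let x := ln (n%:R : R) in let y := ln (p%:R : R) in
  3 * x <= 2 * y ->
  22 * x <= 9 * ((4 + 4 * a) * x + (4 * b - 4) * y) ->
  9 * x - y <= 3 * ((4 + 4 * a) * x + (4 * b - 4) * y) ->
  Mmax R p m n <= p%:R `^ log_loss (1350 * 48 ^+ 3) p *
    ((gcdn m (p - 1))%:R `^ (1 / 4) * n%:R `^ a * p%:R `^ b).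
Proof.
move=> pp m0 n0 np mn x y xy h9 h3.
have N0 : 0 < n%:R :> R by rewrite ltr0n.
have P0 : 0 < p%:R :> R by rewrite ltr0n prime_gt0.
have Nx : n%:R = expR x by rewrite lnK.
have Py : p%:R = expR y by rewrite lnK.
have expX k z : expR z ^+ k = expR (k%:R * z) :> R by rewrite expRM_natl.
pose e := (4 + 4 * a) * x + (4 * b - 4) * y.
have n3 : (n ^ 3 <= p ^ 2)%N by rewrite -(ler_nat R) !natrX Nx Py !expX ler_expR.
have E : (energy 'F_p n)%:R <= 1350 * 48 ^+ 3 * (1 + y) ^+ 2 * expR e.
  apply: energy_Fp_le => //; first exact: expR_gt0.
    by rewrite Nx !expX ler_expR.
  rewrite Nx Py !expX -expRD ler_expR -lerBlDl.
  exact: h3.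
have K0 : 0 < 1350 * 48 ^+ 3 :> R by lra.
move: (1350 * 48 ^+ 3 : R) K0 E => K K0 E.
have loss := log_loss_pow4_ge K0 (prime_gt1 pp).
apply: (@le_of_exp_le _ 3); first by rewrite !mulr_ge0 ?powR_ge0.
set L := _ `^ log_loss _ _ in loss *; set h : R := (gcdn _ _)%:R.
have L0 : 0 <= L by exact: powR_ge0.
rewrite !exprMn (powR_pow4 h) (powR_pow4 n%:R) (powR_pow4 p%:R b).
rewrite (_ : 4 * (1 / 4) = 1); last by field.
rewrite powRr1 ?ler0n // -(ler_pM2l (exprn_gt0 4 N0)).
apply: (le_trans (Mmax_pow4_le R pp m0 n0 np mn)); rewrite -/h.
have -> : n%:R ^+ 4 * (L ^+ 4 * (h * n%:R `^ (4 * a) * p%:R `^ (4 * b))) =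
    p%:R ^+ 4 * h * (L ^+ 4 * expR e).
  have -> : expR e = n%:R ^+ 4 * n%:R `^ (4 * a) * p%:R `^ (4 * b) / p%:R ^+ 4.
    rewrite /powR !gt_eqF // -/x -/y Nx Py !expX -expRN -!expRD; congr expR.
    by rewrite /e; ring.
  by field; rewrite gt_eqF.
rewrite ler_wpM2l ?mulr_ge0 ?exprn_ge0 //; apply: (le_trans E).
by rewrite ler_wpM2r ?expR_ge0.
Qed.

Local Open Scope classical_set_scope.
Local Open Scope ring_scope.

Theorem theorem2p3 (R : realType) :
  exists o : nat -> R, o @ \oo --> (0 : R) /\
  forall p m n : nat,
    prime p -> (0 < m)%N -> (0 < n)%N ->
    (n %| p - 1)%N -> gcdn m n = 1%N ->
    let h : R := (gcdn m (p - 1))%:R in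
    let N : R := n%:R in
    let P : R := p%:R in
    let M : R := Mmax R p m n in
    [/\ P `^ (29 / 48) <= N < P `^ (2 / 3) ->
          M <= P `^ o p * (h `^ (1 / 4) * N `^ (- (1 / 4)) * P `^ (11 / 12)),
        P `^ (59 / 112) <= N < P `^ (29 / 48) ->
          M <= P `^ o p * (h `^ (1 / 4) * N `^ (- (21 / 52)) * P `^ (105 / 104)),
        P `^ (1 / 2) <= N < P `^ (59 / 112) ->
          M <= P `^ o p * (h `^ (1 / 4) * N `^ (- (7 / 20)) * P `^ (157 / 160))
      & N < P `^ (1 / 2) ->
          M <= P `^ o p * (h `^ (1 / 4) * N `^ (- (31 / 80)) * P)].
Proof.
exists (log_loss (1350 * 48 ^+ 3)); split; first exact: log_loss_cvg0.
move=> p m n pp m0 n0 np mn h N P M.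
have N0 : 0 < N by rewrite ltr0n.
have P1 : 1 < P by rewrite ltr1n prime_gt1.
have P0 : 0 < P by exact: lt_trans P1.
have y0 : 0 < ln P by rewrite ln_gt0.
have x0 : 0 <= ln N by rewrite ln_ge0 // ler1n.
have ge a : (P `^ a <= N) = (a * ln P <= ln N).
  by rewrite -(ln_powR P a) ler_ln ?posrE ?powR_gt0.
have lt a : (N < P `^ a) = (ln N < a * ln P).
  by rewrite -(ln_powR P a) ltr_ln ?posrE ?powR_gt0.
(* The required e is 3x - y/3 in the first range, 31x/13 + y/26 in the second, 13x/5 - 3y/40 in the
   third and 49x/20 in the fourth; in each range it dominates both 22x/9 and 3x - y/3. In the second
   range this holds up to x = 29y/48 exactly. *)
split; rewrite ?ge lt.
- by move=> /andP[h1 h2]; apply: Mmax_le_powR => //; rewrite -/N -/P; lra.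
- by move=> /andP[h1 h2]; apply: Mmax_le_powR => //; rewrite -/N -/P; lra.
- by move=> /andP[h1 h2]; apply: Mmax_le_powR => //; rewrite -/N -/P; lra.
- move=> h2; rewrite -[X in _ <= _ * (_ * X)]powRr1 ?(ltW P0) //.
  by apply: Mmax_le_powR => //; rewrite -/N -/P; lra.
Qed.
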